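(* Let $F,f:\mathbb R^n\times\mathbb R^m\to\mathbb R$, $G:\mathbb R^n\times\mathbb R^m\to\mathbb R^q$, $g:\mathbb R^n\times\mathbb R^m\to\mathbb R^p$ be continuously differentiable, where $g$ is quasi-convex in $(x,y)$ on $\mathbb R^n\times\mathbb R^m$ and $f$ is $\rho_f$-weakly convex on $\operatorname{gph}\mathcal F$ with $\rho_f>0$. Let $\gamma\in(0,1/\rho_f)$ and let $(\bar x,\bar y)$ be a local minimizer of $$(\mathrm{VP})_\gamma\qquad\min_{x,y}F(x,y)\quad\text{s.t. } f(x,y)-v_\gamma(x,y)\le0,\ g(x,y)\le0,\ G(x,y)\le0.$$ Suppose that $\mathcal F(x)\ne\emptyset$ for all $x$ in a neighborhood of $\bar x$ and that MSCQ for the system $g(x,y)\le0$ holds at $(\bar x,\bar y)$. Then the critical cone $C(\bar x,\bar y)$ of $(\mathrm{VP})_\gamma$ satisfies $$C(\bar x,\bar y)=\left\{(u,v)\ \middle|\ \begin{array}{l}\nabla f(\bar x,\bar y)(u,v)=\max_{\lambda\in\Lambda(\bar x,\bar y)}\nabla_x\mathcal L(\bar x,\bar y;\lambda)u,\quad\nabla F(\bar x,\bar y)(u,v)\le0,\\ \nabla g_i(\bar x,\bar y)(u,v)\le0\ \forall i\in I_g(\bar x,\bar y),\quad\nabla G_i(\bar x,\bar y)(u,v)\le0\ \forall i\in I_G(\bar x,\bar y)\end{array}\right\}.$$ If, in addition, $(\mathrm{VP})_\gamma$ is partially calm at $(\bar x,\bar y)$ in a direction $(u,v)\in C(\bar x,\bar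 y)$, then there exist $(\alpha,\lambda_g,\lambda_G)\in\mathbb R^{1+p+q}$ and $\bar\lambda\in\Lambda(\bar x,\bar y;u,v)$ satisfying $$0=\nabla F(\bar x,\bar y)+\nabla g(\bar x,\bar y)^T(\lambda_g-\alpha\bar\lambda)+\nabla G(\bar x,\bar y)^T\lambda_G,$$ $$\alpha\ge0,\ 0\le\lambda_g\perp g(\bar x,\bar y),\ \lambda_g\perp\nabla g(\bar x,\bar y)(u,v),\ 0\le\lambda_G\perp G(\bar x,\bar y),\ \lambda_G\perp\nabla G(\bar x,\bar y)(u,v).$$
   Context: Definitions. $\mathcal F(x):=\{y\in\mathbb R^m\mid g(x,y)\le0\}$, $\operatorname{gph}\mathcal F=\{(x,y)\mid y\in\mathcal F(x)\}$; the Moreau envelope function is $v_\gamma(x,y):=\inf_w\{f(x,w)+\frac1{2\gamma}\|w-y\|^2\mid g(x,w)\le0\}$. $g$ quasi-convex: all sublevel sets of each component are convex. $f$ is $\rho$-weakly convex on a convex set $D$ if $f+\frac\rho2\|\cdot\|^2$ is convex on $D$. $I_g(x,y):=\{i\mid g_i(x,y)=0\}$, similarly $I_G$; $\nabla g(x,y)(u,v)$ is the Jacobian applied to $(u,v)$; $a\perp b$ means $\langle a,b\rangle=0$; $\mathbb B$ is the open unit ball; $a_+$ is the componentwise positive part. $\mathcal L(x,y;\lambda):=f(x,y)+g(x,y)^T\lambda$; $\Lambda(x,y):=\{\lambda\in\mathbb R^p_+\mid\nabla_y\mathcal L(x,y;\lambda)=0,\ g(x,y)^T\lambda=0\}$;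 $\Lambda(x,y;u,v):=\{\lambda\in\Lambda(x,y)\mid\lambda^T\nabla g(x,y)(u,v)=0\}$. Critical cone: $C(\bar x,\bar y):=\{(u,v)\mid\nabla f(\bar x,\bar y)(u,v)\le(v_\gamma)'_+(\bar x,\bar y;u,v),\ \nabla F(\bar x,\bar y)(u,v)\le0,\ \nabla g_i(\bar x,\bar y)(u,v)\le0\ \forall i\in I_g(\bar x,\bar y),\ \nabla G_i(\bar x,\bar y)(u,v)\le0\ \forall i\in I_G(\bar x,\bar y)\}$, where $\psi'_+(z;d):=\limsup_{t\downarrow0}\frac{\psi(z+td)-\psi(z)}t$. MSCQ for $g(x,y)\le0$ at $(\bar x,\bar y)$: there are $\epsilon,\kappa>0$ with $\operatorname{dist}((x,y),\{g\le0\})\le\kappa\|g_+(x,y)\|$ for all $(x,y)$ in the $\epsilon$-ball around $(\bar x,\bar y)$. Directional neighborhood: $\mathcal V_{\epsilon,\delta}(d):=\{z\in\epsilon\mathbb B\mid\big\|\|d\|z-\|z\|d\big\|\le\delta\|z\|\|d\|\}$. Partial calmness of $(\mathrm{VP})_\gamma$ at $(\bar x,\bar y)$ in direction $(u,v)$: there are $\epsilon,\delta,\rho>0$ such that for every $(\alpha,\beta)\in\epsilon\mathbb B\subset\mathbb R^{1+q}$ and every $(x,y)\in\operatorname{gph}\mathcal F\cap((\bar x,\bar y)+\mathcal V_{\epsilon,\delta}(u,v))$ with $f(x,y)-v_\gamma(x,y)+\alpha\le0$ and $G(x,y)+\beta\le0$ one has $F(x,y)-F(\bar x,\bar y)+\rho\|(\alpha,\beta)\|\ge0$.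 *)

(* Defs.v *)
(* R^n is 'rV[R]_n and R^n x R^m is 'rV[R]_(n + m): the pair (x, y) is
   row_mx x y, and the components of z are lsubmx z and rsubmx z.
   'rV[R]_n carries the sup norm `|.| in the library; it is used here only
   through the topology (limits, neighbourhoods, differentials).  All
   quantitative notions use the Euclidean norm enorm. *)
From HB Require Import structures.
From mathcomp Require Export all_boot all_order all_algebra.
From mathcomp Require Export all_classical all_reals all_analysis.
Export Order.TTheory GRing.Theory Num.Theory.
Export numFieldNormedType.Exports.

Set Implicit Arguments.
Unset Strict Implicit.
Unset Printing Implicit Defensive.

Local Open Scope classical_set_scope.
Local Open Scope ring_scope.

Section Euclidean.
Context {R : realType}.

Definition dot {k} (a b : 'rV[R]_k) : R := \sum_(i < k) a 0 i * b 0 i.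

Definition enorm {k} (a : 'rV[R]_k) : R := Num.sqrt (dot a a).

Definition edist_set {k} (z : 'rV[R]_k) (A : set 'rV[R]_k) : \bar R :=
  ereal_inf [set (enorm (z - a))%:E | a in A].

Definition pospart {k} (a : 'rV[R]_k) : 'rV[R]_k :=
  \row_i Num.max (a 0 i) 0.

Definition nonneg {k} (a : 'rV[R]_k) : Prop := forall i, 0 <= a 0 i.

Definition nonpos {k} (a : 'rV[R]_k) : Prop := forall i, a 0 i <= 0.

(* In finite dimension, continuity of z |-> 'd f z h for every fixed h is
   continuity of the Jacobian. *)
Definition C1 {k} {W : normedModType R} (f : 'rV[R]_k -> W) : Prop :=
  (forall z, differentiable f z) /\
  (forall h, continuous (fun z => 'd f z h)).

Definition grad {k} (f : 'rV[R]_k -> R) (z : 'rV[R]_k) : 'rV[R]_k :=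
  \row_i 'd f z (delta_mx 0 i).

(* The classical (nabla g(z))^T lam, as a row vector: 'J acts on row vectors
   from the right, h *m 'J g z = 'd g z h. *)
Definition jacT {k l} (g : 'rV[R]_k -> 'rV[R]_l) (z : 'rV[R]_k)
  (lam : 'rV[R]_l) : 'rV[R]_k := lam *m ('J g z)^T.

Definition quasi_convex {k l} (g : 'rV[R]_k -> 'rV[R]_l) : Prop :=
  forall (i : 'I_l) (c : R), convex_set [set z | g z 0 i <= c].

Definition weakly_convex {k} (rho : R) (D : set 'rV[R]_k)
  (f : 'rV[R]_k -> R) : Prop :=
  convex_function D (fun z => f z + rho / 2 * enorm z ^+ 2).

Definition upper_dir_deriv {k} (psi : 'rV[R]_k -> \bar R)
  (z d : 'rV[R]_k) : \bar R :=
  limf_esup (fun t : R => (psi (z + t *: d)%R - psi z) * (t^-1)%:E)%E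
    (0 : R)^'+.

Definition is_local_min {k} (A : set 'rV[R]_k) (F : 'rV[R]_k -> R)
  (z : 'rV[R]_k) : Prop :=
  A z /\ \forall z' \near z, A z' -> F z <= F z'.

Definition is_max (A : set R) (c : R) : Prop := A c /\ ubound A c.

Definition MSCQ {k l} (g : 'rV[R]_k -> 'rV[R]_l) (zb : 'rV[R]_k) : Prop :=
  exists eps kappa : R, [/\ 0 < eps, 0 < kappa &
    forall z, enorm (z - zb) < eps ->
      (edist_set z [set a | nonpos (g a)]
         <= (kappa * enorm (pospart (g z)))%:E)%E].

Definition dir_nbhd {k} (eps delta : R) (d : 'rV[R]_k) : set 'rV[R]_k :=
  [set z | enorm z < eps /\
     enorm (enorm d *: z - enorm z *: d) <= delta * enorm z * enorm d].

End Euclidean.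

Section Bilevel.
Context {R : realType} {n m p q : nat}.
Variables (F f : 'rV[R]_(n + m) -> R) (g : 'rV[R]_(n + m) -> 'rV[R]_p)
  (G : 'rV[R]_(n + m) -> 'rV[R]_q).

Definition lower_feas (x : 'rV[R]_n) : set 'rV[R]_m :=
  [set y | nonpos (g (row_mx x y))].

Definition gph_lower : set 'rV[R]_(n + m) :=
  [set z | lower_feas (lsubmx z) (rsubmx z)].

(* The infimum is taken in \bar R: it is +oo when lower_feas x is empty. *)
Definition moreau (gam : R) (x : 'rV[R]_n) (y : 'rV[R]_m) : \bar R :=
  ereal_inf [set (f (row_mx x w) + (2 * gam)^-1 * enorm (w - y) ^+ 2)%:E
            | w in lower_feas x].

Definition moreau_pair (gam : R) (z : 'rV[R]_(n + m)) : \bar R :=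
  moreau gam (lsubmx z) (rsubmx z).

Definition VP_feas (gam : R) : set 'rV[R]_(n + m) :=
  [set z | [/\ ((f z)%:E - moreau_pair gam z <= 0)%E,
               nonpos (g z) & nonpos (G z)]].

Definition lagr (x : 'rV[R]_n) (y : 'rV[R]_m) (lam : 'rV[R]_p) : R :=
  f (row_mx x y) + dot (g (row_mx x y)) lam.

Definition multipliers (x : 'rV[R]_n) (y : 'rV[R]_m) : set 'rV[R]_p :=
  [set lam | [/\ nonneg lam, grad (fun y' => lagr x y' lam) y = 0
               & dot (g (row_mx x y)) lam = 0]].

Definition dir_multipliers (x : 'rV[R]_n) (y : 'rV[R]_m)
  (u : 'rV[R]_n) (v : 'rV[R]_m) : set 'rV[R]_p :=
  [set lam | multipliers x y lam /\
             dot lam ('d g (row_mx x y) (row_mx u v)) = 0].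

Definition critical_cone (gam : R) (zb : 'rV[R]_(n + m)) :
  set 'rV[R]_(n + m) :=
  [set d | [/\ (('d f zb d)%:E
                 <= upper_dir_deriv (moreau_pair gam) zb d)%E,
               'd F zb d <= 0,
               forall i, g zb 0 i = 0 -> 'd g zb d 0 i <= 0
             & forall i, G zb 0 i = 0 -> 'd G zb d 0 i <= 0]].

Definition partially_calm (gam : R) (zb d : 'rV[R]_(n + m)) : Prop :=
  exists eps delta rho : R, [/\ 0 < eps, 0 < delta, 0 < rho &
    forall (alpha : R) (beta : 'rV[R]_q) (z : 'rV[R]_(n + m)),
      enorm (row_mx (alpha%:M : 'rV[R]_1) beta) < eps ->
      gph_lower z -> dir_nbhd eps delta d (z - zb) ->
      ((f z)%:E - moreau_pair gam z + alpha%:E <= 0)%E ->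
      nonpos (G z + beta) ->
      0 <= F z - F zb + rho * enorm (row_mx (alpha%:M : 'rV[R]_1) beta)].

End Bilevel.

(* Main.v *)
From HB Require Import structures.
Require Import Defs.
From mathcomp Require Import lra ring.

(** Write [C] for the convex set [{g <= 0}] and [zb = (xb, yb)]. Three ideas carry
    the proof; all duality is Farkas' lemma (farkas).

    The envelope is squeezed between linear functions. From above: if [(u, w)]
    satisfies the linearized active constraints, metric subregularity and the
    convexity of [C] give feasible points [zb + t (u, w')] with [w'] close to [w]
    (feasible_curve), and using them as competitors bounds the upper derivative
    of the envelope in direction [(u, v)] by the derivative of [f] along [(u, w)]
    (upper_dir_deriv_le). From below: for a multiplier [lam], weak convexity of
    [f] and quasi-convexity of [g] give a minorant of [f] on [C] whose slope is
    that of the Lagrangian in [x], up to a quadratic term that the proximal term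
    absorbs because [gam < 1 / rho_f] (moreau_lower); so every Lagrangian slope
    bounds the upper derivative from below (upper_dir_deriv_ge).

    These are the values of a linear program and of its dual. If [(u, v)] is
    critical, then [v] minimizes the derivative of [f] along [(u, w)] over the
    linearized feasible [w], and Farkas' lemma applied to the constraints active
    at [v] gives a multiplier, complementary to [(u, v)], whose slope equals the
    derivative of [f] along [(u, v)] (dir_multiplier_exists).
    That yields the formula for the cone (critical_coneE).

    For the stationarity condition fix such a multiplier [lam]. Partial calmness
    is tested on feasible curves tangent to [d + s h], where [h] is linearized
    feasible for the constraints that stay active along [d]. By the minorant
    attached to [lam] the value-function constraint is violated by at most a
    computable first-order amount, so
    [dF h - alpha * <lam, dg h> >= 0] for all such [h], with [alpha] the calmness
    modulus (partially_calm_penalty). Farkas' lemma with the constraints of [g]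
    and [G] together (farkas_pair) turns this into the claimed identity, with
    multipliers supported where both complementarity conditions hold. *)

Set Implicit Arguments.
Unset Strict Implicit.
Unset Printing Implicit Defensive.

Local Open Scope classical_set_scope.
Local Open Scope ring_scope.

(** * The Euclidean norm *)

Section EuclideanNorm.
Context {R : realType}.

Lemma dotC {k} (a b : 'rV[R]_k) : dot a b = dot b a.
Proof. by apply: eq_bigr => i _; rewrite mulrC. Qed.

Lemma dotDl {k} (a b c : 'rV[R]_k) : dot (a + b) c = dot a c + dot b c.
Proof. by rewrite -big_split; apply: eq_bigr => i _; rewrite mxE mulrDl. Qed.

Lemma dotZl {k} s (a b : 'rV[R]_k) : dot (s *: a) b = s * dot a b.
Proof. by rewrite /dot mulr_sumr; apply: eq_bigr => i _; rewrite mxE mulrA. Qed.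

Lemma dotDr {k} (a b c : 'rV[R]_k) : dot c (a + b) = dot c a + dot c b.
Proof. by rewrite dotC dotDl !(dotC _ c). Qed.

Lemma dotZr {k} s (a b : 'rV[R]_k) : dot a (s *: b) = s * dot a b.
Proof. by rewrite dotC dotZl dotC. Qed.

Lemma dotBl {k} (a b c : 'rV[R]_k) : dot (a - b) c = dot a c - dot b c.
Proof. by rewrite dotDl -scaleN1r dotZl mulN1r. Qed.

Lemma dot0r {k} (a : 'rV[R]_k) : dot a 0 = 0.
Proof. by rewrite -(scale0r (0 : 'rV[R]_k)) dotZr mul0r. Qed.

Lemma dotvv_ge0 {k} (a : 'rV[R]_k) : 0 <= dot a a.
Proof. by apply: sumr_ge0 => i _; rewrite -expr2 sqr_ge0. Qed.

Lemma dot_row_mx {k l} (a c : 'rV[R]_k) (b d : 'rV[R]_l) :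
  dot (row_mx a b) (row_mx c d) = dot a c + dot b d.
Proof.
rewrite /dot big_split_ord/=; congr (_ + _); apply: eq_bigr => i _.
  by rewrite !row_mxEl.
by rewrite !row_mxEr.
Qed.

Lemma enorm_ge0 {k} (a : 'rV[R]_k) : 0 <= enorm a.
Proof. exact: sqrtr_ge0. Qed.

Lemma enorm_sqr {k} (a : 'rV[R]_k) : enorm a ^+ 2 = dot a a.
Proof. by rewrite sqr_sqrtr// dotvv_ge0. Qed.

Lemma enormZ {k} s (a : 'rV[R]_k) : enorm (s *: a) = `|s| * enorm a.
Proof.
by rewrite /enorm dotZl dotZr mulrA -expr2 sqrtrM ?sqr_ge0// sqrtr_sqr.
Qed.

Lemma enorm0 {k} : enorm (0 : 'rV[R]_k) = 0.
Proof. by rewrite -(scale0r (0 : 'rV[R]_k)) enormZ normr0 mul0r. Qed.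

Lemma enormN {k} (a : 'rV[R]_k) : enorm (- a) = enorm a.
Proof. by rewrite -scaleN1r enormZ normrN1 mul1r. Qed.

Lemma enormB {k} (a b : 'rV[R]_k) : enorm (a - b) = enorm (b - a).
Proof. by rewrite -opprB enormN. Qed.

(** The Cauchy-Schwarz inequality: the quadratic
    [t |-> dot (a + t b) (a + t b)] is nonnegative at its minimizer. *)
Lemma dot_le_enorm {k} (a b : 'rV[R]_k) : dot a b <= enorm a * enorm b.
Proof.
have Q t : 0 <= dot a a + 2 * t * dot a b + t ^+ 2 * dot b b.
  have := dotvv_ge0 (a + t *: b).
  rewrite !(dotDl, dotDr, dotZl, dotZr) (dotC b a); congr (_ <= _); ring.
suff H : dot a b ^+ 2 <= dot a a * dot b b.
  rewrite /enorm -sqrtrM ?dotvv_ge0// (le_trans (ler_norm _))//.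
  by rewrite -sqrtr_sqr ler_sqrt// mulr_ge0 ?dotvv_ge0.
have [b0|b0] := eqVneq (dot b b) 0.
  have [->|ab0] := eqVneq (dot a b) 0; first by rewrite b0; lra.
  (* With b isotropic the quadratic is affine in t; this t sends it to -1. *)
  have := Q (- (dot a a + 1) / (2 * dot a b)); rewrite b0.
  suff -> : dot a a + 2 * (- (dot a a + 1) / (2 * dot a b)) * dot a b +
     (- (dot a a + 1) / (2 * dot a b)) ^+ 2 * 0 = -1 by lra.
  by move: ab0; set x := dot a b; set y := dot a a => ab0; field.
have bp : 0 < dot b b by rewrite lt_neqAle eq_sym b0 dotvv_ge0.
have := Q (- dot a b / dot b b).
rewrite -(pmulr_lge0 _ bp) => Qb; rewrite -subr_ge0; apply: le_trans Qb _.
rewrite le_eqVlt; apply/orP; left; apply/eqP.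
by move: b0; set x := dot a b; set y := dot a a; set z := dot b b => b0; field.
Qed.

Lemma enormD {k} (a b : 'rV[R]_k) : enorm (a + b) <= enorm a + enorm b.
Proof.
rewrite -(@ler_pXn2r _ 2)// ?nnegrE ?addr_ge0 ?enorm_ge0//.
rewrite sqrrD !enorm_sqr dotDl !dotDr (dotC b a).
by have := dot_le_enorm a b; lra.
Qed.

Lemma ler_enorm_norm {k} (a b : 'rV[R]_k) :
  `|enorm a - enorm b| <= enorm (a - b).
Proof.
have := enormD (a - b) b; have := enormD (b - a) a.
rewrite !subrK enormB => ? ?; rewrite ler_norml; lra.
Qed.

Lemma coord_le_enorm {k} (a : 'rV[R]_k) i : `|a 0 i| <= enorm a.
Proof.
rewrite -sqrtr_sqr ler_sqrt ?dotvv_ge0// /dot (bigD1 i)//= -expr2 lerDl.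
by apply: sumr_ge0 => j _; rewrite -expr2 sqr_ge0.
Qed.

Lemma norm_le_enorm {k} (a : 'rV[R]_k) : `|a| <= enorm a.
Proof.
have -> : `|a| = mx_norm a by [].
rewrite mx_normrE; apply: bigmax_le; first exact: enorm_ge0.
by case=> i j _ /=; rewrite (ord1 i) coord_le_enorm.
Qed.

Lemma enorm_delta {k} (i : 'I_k) : enorm (delta_mx 0 i : 'rV[R]_k) = 1.
Proof.
rewrite /enorm (_ : dot _ _ = 1) ?sqrtr1//.
rewrite /dot (bigD1 i)//= big1 ?addr0 ?mxE ?eqxx ?mulr1// => j /negPf ji.
by rewrite mxE ji andbF mul0r.
Qed.

Lemma enorm_sum {k} (I : Type) (r : seq I) (a : I -> 'rV[R]_k) :
  enorm (\sum_(i <- r) a i) <= \sum_(i <- r) enorm (a i).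
Proof.
elim/big_ind2 : _ => //; first by rewrite enorm0.
move=> x s y t xs yt; apply: (le_trans (enormD _ _)); exact: lerD.
Qed.

Lemma enorm_le_sum {k} (a : 'rV[R]_k) : enorm a <= \sum_i `|a 0 i|.
Proof.
rewrite {1}(row_sum_delta a) (le_trans (enorm_sum _ _))//.
by apply: ler_sum => i _; rewrite enormZ enorm_delta mulr1.
Qed.

Lemma enorm_row_mx {k l} (a : 'rV[R]_k) (b : 'rV[R]_l) :
  enorm (row_mx a b) ^+ 2 = enorm a ^+ 2 + enorm b ^+ 2.
Proof. by rewrite !enorm_sqr dot_row_mx. Qed.

Lemma enorm_row0mx {k l} (b : 'rV[R]_l) :
  enorm (row_mx (0 : 'rV[R]_k) b) = enorm b.
Proof. by rewrite /enorm dot_row_mx dot0r add0r. Qed.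

Lemma enorm_row_mx0 {k l} (b : 'rV[R]_k) :
  enorm (row_mx b (0 : 'rV[R]_l)) = enorm b.
Proof. by rewrite /enorm dot_row_mx dot0r addr0. Qed.

End EuclideanNorm.

(** * Farkas' lemma *)

Section Farkas.
Context {R : realType} {V : lmodType R}.

(** Linearity as a predicate on bare functions: the induction for Farkas' lemma
    builds new functionals by composing with a projection. *)
Definition lin_form (a : V -> R) : Prop :=
  forall s x y, a (s *: x + y) = s * a x + a y.

Lemma lin_formB a s x y : lin_form a -> a (x - s *: y) = a x - s * a y.
Proof. by move=> la; rewrite addrC -scaleNr la mulNr addrC. Qed.

Lemma lin_formZ a s x : lin_form a -> a (s *: x) = s * a x.
Proof.
move=> la; have a0 : a 0 = 0.
  by have := la (-1) 0 0; rewrite scaler0 addr0 mulN1r addNr.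
by rewrite -[s *: x]addr0 la a0 addr0.
Qed.

(** Farkas' lemma by induction on the list of constraints, without any topology.
    If the constraint [a j] is needed, some [x0] satisfies the others while
    [b x0 > 0], so [a j x0 > 0]. Projecting along [x0] onto the kernel of [a j]
    gives a problem with one constraint fewer; its multipliers work for the
    original problem, and the coefficient of [a j] that they force is
    nonnegative by the choice of [x0]. *)
Lemma farkas_seq (I : eqType) (s : seq I) (a : I -> V -> R) (b : V -> R) :
  uniq s -> (forall i, lin_form (a i)) -> lin_form b ->
  (forall x, (forall i, i \in s -> a i x <= 0) -> b x <= 0) ->
  exists l : I -> R, (forall i, 0 <= l i) /\
    forall x, b x = \sum_(i <- s) l i * a i x.
Proof.
move=> + + +; elim: s a b => [|j s IH] a b.
  move=> _ _ lb H; exists (fun=> 0); split=> // x; rewrite big_nil.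
  have := H (-1 *: x); rewrite lin_formZ// mulN1r => H1.
  by apply/eqP; rewrite eq_le H// -oppr_le0 H1.
move=> /= /andP[js us] la lb H.
have [|/existsNP[x0 /not_implyP[ax0 /negP]]] :=
  pselect (forall x, (forall i, i \in s -> a i x <= 0) -> b x <= 0).
  move=> /(IH a b us la lb)[l [l0 bE]].
  exists (fun i => if i == j then 0 else l i); split.
    by move=> i; case: ifP.
  move=> x; rewrite big_cons eqxx mul0r add0r bE.
  by apply: eq_big_seq => i si; case: eqP => // ij; rewrite -ij si in js.
rewrite -ltNge => bx0.
have c0 : 0 < a j x0.
  rewrite ltNge; apply/negP => ajx0.
  have : b x0 <= 0; last by rewrite leNgt bx0.
  by apply: H => i; rewrite in_cons => /predU1P[->|]//; exact: ax0.
pose pr x := x - (a j x / a j x0) *: x0.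
have lpr f : lin_form f -> lin_form (f \o pr).
  move=> lf t x y; rewrite /pr/= !(lin_formB, lf, la)//.
  by ring.
have ajpr x : a j (pr x) = 0 by rewrite lin_formB// divfK ?subrr// gt_eqF.
have [||x H0|l [l0 bE]] := IH (fun i => a i \o pr) (b \o pr) us.
- by move=> i; exact: lpr.
- exact: lpr.
- apply: H => i; rewrite in_cons => /predU1P[->|]; first by rewrite ajpr.
  exact: H0.
pose c := (b x0 - \sum_(i <- s) l i * a i x0) / a j x0.
exists (fun i => if i == j then c else l i); split.
  move=> i; case: ifP => // _; rewrite divr_ge0 ?(ltW c0)// subr_ge0.
  rewrite (le_trans _ (ltW bx0))// big_seq sumr_le0// => k sk.
  by rewrite mulr_ge0_le0// ax0.
move=> x; rewrite big_cons eqxx.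
have -> : \sum_(i <- s) (if i == j then c else l i) * a i x =
    \sum_(i <- s) l i * a i x.
  by apply: eq_big_seq => i si; case: eqP => // ij; rewrite -ij si in js.
have := bE x; rewrite /pr/= lin_formB//.
under eq_bigr do rewrite lin_formB// mulrBr mulrCA.
rewrite sumrB -mulr_sumr => E.
have -> : b x = a j x / a j x0 * b x0 + (b x - a j x / a j x0 * b x0) by ring.
by rewrite E /c; ring.
Qed.

(** Selecting the constraints by a predicate builds complementary slackness into
    the conclusion. *)
Lemma farkas (I : finType) (P : pred I) (a : I -> V -> R) (b : V -> R) :
  (forall i, lin_form (a i)) -> lin_form b ->
  (forall x, (forall i, P i -> a i x <= 0) -> b x <= 0) ->
  exists l : I -> R, [/\ (forall i, 0 <= l i), (forall i, ~~ P i -> l i = 0) &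
    forall x, b x = \sum_i l i * a i x].
Proof.
move=> la lb H; have [x Hx|l [l0 bE]] := farkas_seq (enum_uniq P) la lb.
  by apply: H => i Pi; apply: Hx; rewrite mem_enum.
exists (fun i => if P i then l i else 0); split.
- by move=> i; case: ifP.
- by move=> i /negPf ->.
move=> x; rewrite bE big_enum/= [RHS](bigID P)/= [X in _ + X]big1 ?addr0.
  by apply: eq_bigr => i iP; rewrite ifT.
by move=> i /negPf ->; rewrite mul0r.
Qed.

End Farkas.

(** * Differentials and first-order expansions *)

Section Differentials.
Context {R : realType}.

(** A linear map on a space of row vectors is the combination of its values on the
    canonical basis, with the continuous coordinates as coefficients. *)
Lemma linear_rV_continuous {k} {W : normedModType R}
  (L : {linear 'rV[R]_k -> W}) : continuous L.
Proof.
move=> y.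
have -> : (L : 'rV[R]_k -> W) = fun x => \sum_i x 0 i *: L (delta_mx 0 i).
  apply/funext => x; rewrite [in LHS](row_sum_delta x) linear_sum/=.
  by under eq_bigr do rewrite linearZ.
apply: (@cvg_big W 'I_k +%R 0 xpredT add_continuous 'rV[R]_k (nbhs y)
  (index_enum 'I_k) (fun i x => x 0 i *: L (delta_mx 0 i))
  (fun i => y 0 i *: L (delta_mx 0 i)) _) => i _.
by apply: cvgZr_tmp; exact: coord_continuous.
Qed.

Lemma linear_comp_diff {k} {V W : normedModType R} (L : {linear 'rV[R]_k -> W})
    (g : V -> 'rV[R]_k) z : differentiable g z ->
  is_diff z (fun x => L (g x)) (fun h => L ('d g z h)).
Proof.
move=> dg; have Lc := @linear_rV_continuous _ _ L.
have dL : differentiable L (g z) by exact: linear_differentiable.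
apply: DiffDef; first exact: (@differentiable_comp _ _ _ _ g L).
by rewrite (@diff_comp _ _ _ _ g L)// diff_lin.
Qed.

Lemma coord_diff {k} {V : normedModType R} (g : V -> 'rV[R]_k) i z :
    differentiable g z ->
  is_diff z (fun x => g x 0 i) (fun h => 'd g z h 0 i).
Proof.
move=> dg.
have lc : linear (fun y : 'rV[R]_k => y 0 i : R) by move=> s x y; rewrite !mxE.
pose L : {linear 'rV[R]_k -> R} :=
  HB.pack (fun y : 'rV[R]_k => y 0 i : R) (GRing.isLinear.Build _ _ _ _ _ lc).
exact: (@linear_comp_diff _ _ _ L).
Qed.

Lemma dot_diff {k} {V : normedModType R} (g : V -> 'rV[R]_k) l z :
    differentiable g z ->
  is_diff z (fun x => dot (g x) l) (fun h => dot ('d g z h) l).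
Proof.
move=> dg.
have lc : linear (fun y : 'rV[R]_k => dot y l : R).
  by move=> s x y; rewrite dotDl dotZl.
pose L : {linear 'rV[R]_k -> R} :=
  HB.pack (fun y : 'rV[R]_k => dot y l : R) (GRing.isLinear.Build _ _ _ _ _ lc).
exact: (@linear_comp_diff _ _ _ L).
Qed.

Lemma affine_precomp_diff {k l} {W : normedModType R}
    (L : {linear 'rV[R]_k -> 'rV[R]_l}) c (f : 'rV[R]_l -> W) y :
    differentiable f (c + L y) ->
  is_diff y (fun x => f (c + L x)) (fun h => 'd f (c + L y) (L h)).
Proof.
move=> df; have Lc := @linear_rV_continuous _ _ L.
have dL : differentiable L y by exact: linear_differentiable.
pose A x := c + L x.
have dA : is_diff y A L.
  rewrite (_ : A = cst c + L); last by apply/funext.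
  have dc : differentiable (cst c : 'rV[R]_k -> _) y.
    exact: differentiable_cst.
  apply: DiffDef; first exact: differentiableD.
  rewrite (@diffD _ _ _ (cst c) L y dc dL) -[RHS]add0r.
  by congr (_ + _); [exact: diff_cst | exact: diff_lin].
have dA' := @ex_diff _ _ _ _ _ _ _ dA.
apply: DiffDef; first exact: (@differentiable_comp _ _ _ _ A f).
by rewrite (@diff_comp _ _ _ _ A f)// diff_val.
Qed.

Lemma row_mx0_linear {n m} :
  linear (fun u : 'rV[R]_n => row_mx u (0 : 'rV[R]_m)).
Proof. by move=> s x y; rewrite scale_row_mx add_row_mx scaler0 addr0. Qed.

Lemma row_0mx_linear {n m} :
  linear (fun v : 'rV[R]_m => row_mx (0 : 'rV[R]_n) v).
Proof. by move=> s x y; rewrite scale_row_mx add_row_mx scaler0 addr0. Qed.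

Lemma partial_left_diff {n m} {W : normedModType R}
    (f : 'rV[R]_(n + m) -> W) x y : differentiable f (row_mx x y) ->
  is_diff x (fun x' => f (row_mx x' y))
    (fun u => 'd f (row_mx x y) (row_mx u 0)).
Proof.
pose L : {linear 'rV[R]_n -> 'rV[R]_(n + m)} :=
  HB.pack (fun u : 'rV[R]_n => row_mx u (0 : 'rV[R]_m))
    (GRing.isLinear.Build _ _ _ _ _ row_mx0_linear).
have LE x' : row_mx 0 y + L x' = row_mx x' y by rewrite add_row_mx add0r addr0.
have -> : (fun x' => f (row_mx x' y)) = (fun x' => f (row_mx 0 y + L x')).
  by apply/funext => x'; rewrite LE.
by rewrite -LE; exact: affine_precomp_diff.
Qed.

Lemma partial_right_diff {n m} {W : normedModType R}
    (f : 'rV[R]_(n + m) -> W) x y : differentiable f (row_mx x y) ->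
  is_diff y (fun y' => f (row_mx x y'))
    (fun v => 'd f (row_mx x y) (row_mx 0 v)).
Proof.
pose L : {linear 'rV[R]_m -> 'rV[R]_(n + m)} :=
  HB.pack (fun v : 'rV[R]_m => row_mx (0 : 'rV[R]_n) v)
    (GRing.isLinear.Build _ _ _ _ _ row_0mx_linear).
have LE y' : row_mx x 0 + L y' = row_mx x y' by rewrite add_row_mx add0r addr0.
have -> : (fun y' => f (row_mx x y')) = (fun y' => f (row_mx x 0 + L y')).
  by apply/funext => y'; rewrite LE.
by rewrite -LE; exact: affine_precomp_diff.
Qed.

(** Frechet differentiability in the form used throughout: the first-order
    expansion along [t h] is uniform over directions close to [h]. Feasible
    curves are only tangent to a prescribed direction, hence the moving [h']. *)
Lemma hadamard_expansion {k} (F : 'rV[R]_k -> R) z h e :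
    differentiable F z -> 0 < e ->
  exists2 eta, 0 < eta & \forall t \near 0^'+, forall h', enorm (h' - h) <= eta ->
    `|F (z + t *: h') - F z - t * 'd F z h| <= e * t.
Proof.
move=> dF e0; have [K K0 HK] := linear_lipschitz (diff_continuous dF).
pose eta := e / (2 * K); have eta0 : 0 < eta by rewrite divr_gt0// mulr_gt0.
exists eta => //.
pose M := enorm h + eta; have M0 : 0 < M.
  by rewrite ltr_wpDl// enorm_ge0.
have e'0 : 0 < e / (2 * M) by rewrite divr_gt0// mulr_gt0.
have /eqaddoP/(_ _ e'0)/nbhs_ballP[d /= d0 Hd] := diff_locally dF.
near=> t => h' hh'.
have t0 : 0 < t by near: t; exact: nbhs_right_gt.
have h'M : enorm h' <= M.
  by rewrite -[h'](subrK h) (le_trans (enormD _ _))// addrC lerD2l.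
have : ball 0 d (t *: h').
  rewrite -ball_normE/= sub0r normrN.
  rewrite (le_lt_trans (norm_le_enorm _))// enormZ gtr0_norm//.
  rewrite (@le_lt_trans _ _ (t * M))// ?ler_pM2l// -ltr_pdivlMr//.
  by near: t; apply: nbhs_right_lt; rewrite divr_gt0.
move=> /Hd H0.
have {H0} H1 : `|F (z + t *: h') - (F z + t * 'd F z h')| <=
    e / (2 * M) * `|t *: h'|.
  have <- : 'd F z (t *: h') = t * 'd F z h' by rewrite linearZ.
  by rewrite [z + _]addrC; exact: H0.
have H2 : `|'d F z h' - 'd F z h| <= e / 2.
  rewrite -linearB (le_trans (HK _))//.
  rewrite (@le_trans _ _ (K * eta))//.
    by rewrite ler_pM2l// (le_trans (norm_le_enorm _)).
  rewrite le_eqVlt; apply/orP; left; apply/eqP.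
  by rewrite /eta; field; rewrite gt_eqF.
have H3 : e / (2 * M) * `|t *: h'| <= e / 2 * t.
  rewrite (@le_trans _ _ (e / (2 * M) * (t * M)))//.
    rewrite ler_pM2l// (le_trans (norm_le_enorm _))// enormZ gtr0_norm//.
    by rewrite ler_pM2l.
  by rewrite le_eqVlt; apply/orP; left; apply/eqP; field; rewrite gt_eqF.
have -> : F (z + t *: h') - F z - t * 'd F z h =
  (F (z + t *: h') - (F z + t * 'd F z h')) + t * ('d F z h' - 'd F z h).
  by ring.
rewrite (le_trans (ler_normD _ _))//.
rewrite (_ : e * t = e / 2 * t + t * (e / 2)); last by field.
apply: lerD; first exact: le_trans H1 H3.
by rewrite normrM gtr0_norm// ler_pM2l.
Unshelve. all: by end_near. Qed.

Lemma hadamard_coord {k l} (g : 'rV[R]_k -> 'rV[R]_l) i z h e :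
    differentiable g z -> 0 < e ->
  exists2 eta, 0 < eta & \forall t \near 0^'+, forall h', enorm (h' - h) <= eta ->
    `|g (z + t *: h') 0 i - g z 0 i - t * 'd g z h 0 i| <= e * t.
Proof.
move=> dg e0; have dgi := coord_diff i dg.
have -> : 'd g z h 0 i = 'd (fun x => g x 0 i) z h by rewrite diff_val.
exact: (@hadamard_expansion _ (fun x => g x 0 i) z h e
  (@ex_diff _ _ _ _ _ _ _ dgi)).
Qed.

End Differentials.

(** * Convex sets and feasible curves *)

Section ConvexSets.
Context {R : realType}.

(** Convexity with a real weight, in the affine form [a + s (b - a)] that matches
    first-order expansions. *)
Definition segment_closed {V : lmodType R} (A : set V) : Prop :=
  forall a b s, A a -> A b -> 0 <= s -> s <= 1 -> A (a + s *: (b - a)).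

Lemma convE {V : lmodType R} (a b : convex_lmodType V) s (s0 : 0 <= s)
  (s1 : s <= 1) : conv (Itv01 s0 s1) b a = (a : V) + s *: ((b : V) - a).
Proof.
rewrite [LHS](_ : _ = s *: (b : V) + (1 - s) *: (a : V))//.
by rewrite scalerBl scale1r scalerBr addrCA.
Qed.

Lemma convex_set_segment {V : lmodType R} (A : set V) :
  convex_set A -> segment_closed A.
Proof.
move=> cA a b s Aa Ab s0 s1.
have := cA b a (Itv01 s0 s1); rewrite !inE convE.
by apply.
Qed.

Lemma convex_function_segment {V : lmodType R} (A : set V) (f : V -> R) a b s :
  convex_function A f -> A a -> A b -> 0 <= s -> s <= 1 ->
  f (a + s *: (b - a)) <= f a + s * (f b - f a).
Proof.
move=> cf Aa Ab s0 s1.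
have := cf (Itv01 s0 s1) b a; rewrite !inE convE => /(_ Ab Aa).
by rewrite convRE/= /unstable.onem; congr (_ <= _); ring.
Qed.

Lemma quasi_convex_segment {k l} (g : 'rV[R]_k -> 'rV[R]_l) :
  quasi_convex g -> segment_closed [set z | nonpos (g z)].
Proof.
move=> qc a b s ga gb s0 s1 i.
exact: (convex_set_segment (qc i 0) (ga i) (gb i) s0 s1).
Qed.

Lemma segment_closed_sum {V : lmodType R} (A : set V) (I : eqType)
    (r : seq I) (h : I -> V) (c : I -> R) z :
  segment_closed A -> A z -> (forall i, A (z + h i)) -> (forall i, 0 <= c i) ->
  \sum_(i <- r) c i <= 1 -> A (z + \sum_(i <- r) c i *: h i).
Proof.
move=> sA Az Ah; elim: r c => [|j r IH] c c0.
  by rewrite !big_nil addr0.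
rewrite !big_cons => c1.
have S0 : 0 <= \sum_(i <- r) c i by exact: sumr_ge0.
have [cj1|cj1] := eqVneq (c j) 1.
  have /eqP : \sum_(i <- r) c i = 0 by have := c0 j; lra.
  rewrite psumr_eq0// => /allP c0r.
  rewrite (_ : \sum_(i <- r) c i *: h i = 0); first by rewrite cj1 scale1r addr0.
  by rewrite big_seq big1// => i /c0r/= /eqP ->; rewrite scale0r.
have t0 : 0 < 1 - c j by move/eqP: cj1; have := c0 j; lra.
have := IH (fun i => c i / (1 - c j)).
rewrite -mulr_suml ler_pdivrMr// mul1r => Aw.
have {}Aw := Aw (fun i => divr_ge0 (c0 i) (ltW t0)) ltac:(lra).
have := sA _ _ (c j) Aw (Ah j) (c0 j).
have -> : c j <= 1 by lra.
move=> /(_ isT); congr (A _).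
under [in LHS]eq_bigr do rewrite mulrC -scalerA.
rewrite -scaler_sumr; set w := \sum_(i <- r) _.
rewrite opprD addrACA subrr add0r scalerBr scalerA -addrA; congr (_ + _).
rewrite addrCA; congr (_ + _); rewrite -scalerBl.
by rewrite -[X in _ = X]scale1r; congr (_ *: _); field; rewrite gt_eqF.
Qed.

(** Near [x] the fibres of a convex set whose projection is a neighbourhood of [x]
    meet a common ball: pick a point above each of the [2 n] vertices
    [x +- r e_i] of a cross-polytope and take convex combinations. *)
Lemma near_fiber_selection {n m} (A : set 'rV[R]_(n + m)) x y :
    segment_closed A -> A (row_mx x y) ->
    (\forall x' \near x, exists y', A (row_mx x' y')) ->
  exists2 r, 0 < r & exists M, forall e : 'rV[R]_n, \sum_i `|e 0 i| <= r ->
    exists2 h : 'rV[R]_m, enorm h <= M & A (row_mx (x + e) (y + h)).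
Proof.
move=> sA Axy /nbhs_ballP[d /= d0 Hd].
pose r := d / 2; have r0 : 0 < r by rewrite divr_gt0.
pose vert (ib : 'I_n * bool) : 'rV[R]_n :=
  ((-1) ^+ ib.2 * r) *: delta_mx 0 ib.1.
have /choice[Y HY] : forall ib, exists y', A (row_mx (x + vert ib) y').
  move=> ib; apply: Hd; rewrite -ball_normE/= opprD addrA subrr add0r normrN.
  rewrite (le_lt_trans (norm_le_enorm _))// enormZ enorm_delta mulr1.
  by rewrite normrMsign gtr0_norm// /r; lra.
exists r => //.
exists (\sum_i (enorm (Y (i, false) - y) + enorm (Y (i, true) - y))) => e er.
pose b i := e 0 i < 0.
pose c i := `|e 0 i| / r.
pose h i := row_mx (vert (i, b i)) (Y (i, b i) - y).
have c0 i : 0 <= c i by rewrite divr_ge0// ltW.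
have c1 : \sum_i c i <= 1 by rewrite -mulr_suml ler_pdivrMr// mul1r.
have cle1 i : c i <= 1.
  by rewrite (le_trans _ c1)// (bigD1 i)//= lerDl sumr_ge0.
have := segment_closed_sum (r := index_enum 'I_n) (h := h) sA Axy _ c0 c1.
have Ah i : A (row_mx x y + h i).
  by rewrite /h add_row_mx addrCA subrr addr0; exact: HY.
move=> /(_ Ah) HA.
have SE : \sum_i c i *: h i = row_mx e (\sum_i c i *: (Y (i, b i) - y)).
  rewrite [in RHS](row_sum_delta e).
  have -> : \sum_i c i *: h i =
      \sum_i row_mx (e 0 i *: delta_mx 0 i) (c i *: (Y (i, b i) - y)).
    apply: eq_bigr => i _; rewrite scale_row_mx /vert/= scalerA.
    congr (row_mx (_ *: _) _).
    rewrite mulrCA /c divfK ?gt_eqF//.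
    by rewrite /b -realEsign// num_real.
  elim: (index_enum 'I_n) => [|j s IH]; first by rewrite !big_nil row_mx0.
  by rewrite !big_cons IH add_row_mx.
rewrite SE add_row_mx in HA.
exists (\sum_i c i *: (Y (i, b i) - y)) => //.
rewrite (le_trans (enorm_sum _ _))//; apply: ler_sum => i _.
rewrite enormZ ger0_norm// (@le_trans _ _ (enorm (Y (i, b i) - y)))//.
  by rewrite ler_piMl// enorm_ge0.
by case: (b i); rewrite ?lerDl ?lerDr enorm_ge0.
Qed.

(** A feasible point whose first component misses the prescribed one by at most
    [t eta] is moved into the right fibre by mixing in, with weight [t sg], a
    feasible point above the reflected error. The weight is small with [t], and
    near_fiber_selection bounds the point, so the direction changes by at most
    [e]. *)
Lemma fiber_correction {n m} (A : set 'rV[R]_(n + m)) x y u v e :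
    segment_closed A -> A (row_mx x y) ->
    (\forall x' \near x, exists y', A (row_mx x' y')) -> 0 < e ->
  exists2 eta, 0 < eta & \forall t \near 0^'+, forall u' v',
    enorm (u' - u) <= eta -> enorm (v' - v) <= eta ->
    A (row_mx x y + t *: row_mx u' v') ->
    exists2 w, enorm (w - v) <= e & A (row_mx x y + t *: row_mx u w).
Proof.
move=> sA Axy Anear e0.
have [r r0 [M HM]] := near_fiber_selection sA Axy Anear.
have M0 : 0 <= M.
  have [|h hM _] := HM 0; last exact: le_trans (enorm_ge0 h) hM.
  by rewrite big1 ?(ltW r0)// => i _; rewrite mxE normr0.
(* N keeps the correcting displacement within the radius r; K bounds the change
   of the second direction in units of eta. *)
pose N : R := 2 * n.+1%:R / r; have N0 : 0 < N by rewrite divr_gt0// mulr_gt0.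
pose K := 1 + N * (M + enorm v + 1).
have K0 : 0 < K.
  by rewrite ltr_pwDl// mulr_ge0 ?(ltW N0)// !addr_ge0// enorm_ge0.
pose eta := Num.min 1 (e / K).
have eta0 : 0 < eta by rewrite lt_min ltr01 divr_gt0.
have eta1 : eta <= 1 by rewrite ge_min lexx.
have etaK : eta * K <= e by rewrite -ler_pdivlMr// ge_min lexx orbT.
exists eta => //.
pose sg := N * eta; have sg0 : 0 < sg by rewrite mulr_gt0.
pose U := \sum_i `|u 0 i|; have U0 : 0 <= U by exact: sumr_ge0.
near=> t => u' v' uu' vv' At.
have t0 : 0 < t by near: t; exact: nbhs_right_gt.
have t1 : t <= 1 by near: t; exact: nbhs_right_le.
have tsg : t * sg <= 1.
  rewrite -ler_pdivlMr//; near: t; apply: nbhs_right_le.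
  by rewrite divr_gt0.
have tU : t * U <= r / 2.
  rewrite (@le_trans _ _ (t * (U + 1)))//; first by rewrite ler_pM2l// lerDl.
  rewrite -ler_pdivlMr ?ltr_wpDl//; near: t; apply: nbhs_right_le.
  by rewrite !divr_gt0// ltr_wpDl.
(* The displacement for which the mixture has first component x + t u. *)
pose ep := t *: u - ((1 - t * sg) / sg) *: (u' - u).
have [|h hM Ah] := HM ep.
  rewrite (@le_trans _ _ (\sum_i (t * `|u 0 i| + eta / sg)))//.
    apply: ler_sum => i _; rewrite !mxE (le_trans (ler_normB _ _))//.
    rewrite !normrM (gtr0_norm t0) lerD2l normfV (gtr0_norm sg0).
    have c1 : `|1 - t * sg| <= 1.
      by rewrite ger0_norm ?subr_ge0// gerBl mulr_ge0// ltW.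
    have := coord_le_enorm (u' - u) i; rewrite !mxE => c2.
    rewrite -mulrA mulrC -mulrA mulrC ler_pM2r ?invr_gt0//.
    rewrite -[eta]mulr1 ler_pM//; exact: le_trans uu'.
  rewrite big_split/= -mulr_sumr sumr_const card_ord -/U.
  have -> : eta / sg = r / 2 / n.+1%:R.
    have q0 : 0 < n.+1%:R :> R by [].
    rewrite /sg /N; move: (n.+1%:R : R) q0 => q' q0.
    by field; rewrite !gt_eqF.
  have : (r / 2 / n.+1%:R) *+ n <= r / 2.
    rewrite -mulr_natr -mulrA ler_piMr ?divr_ge0 ?(ltW r0)//.
    by rewrite mulrC ler_pdivrMr ?ltr0n// mul1r ler_nat.
  move: (_ *+ n) => X; lra.
exists (v' + sg *: (h - t *: v')).
  have -> : v' + sg *: (h - t *: v') - v = (v' - v) + sg *: (h - t *: v').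
    by rewrite addrAC.
  rewrite (le_trans (enormD _ _))// enormZ gtr0_norm//.
  have B1 : enorm v' <= enorm v + 1.
    rewrite -[v'](subrK v) (le_trans (enormD _ _))// addrC lerD2l.
    exact: le_trans eta1.
  have B2 : enorm (h - t *: v') <= M + enorm v + 1.
    rewrite (le_trans (enormD _ _))// enormN enormZ gtr0_norm// -addrA lerD//.
    by rewrite (le_trans _ B1)// ler_piMl ?enorm_ge0.
  rewrite (le_trans _ etaK)// /K mulrDr mulr1 lerD// /sg (mulrC N) -mulrA.
  by rewrite ler_pM2l// ler_pM2l.
have := sA _ _ (t * sg) At Ah (mulr_ge0 (ltW t0) (ltW sg0)) tsg.
congr (A _); rewrite !scale_row_mx !add_row_mx opp_row_mx add_row_mx.
rewrite scale_row_mx add_row_mx; congr row_mx; apply/matrixP => i j; rewrite !mxE.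
  by field; rewrite gt_eqF.
by ring.
Unshelve. all: by end_near. Qed.

(** Along a direction that is linearized feasible at the active constraints the
    violation is of lower order than [t]; the inactive constraints stay negative
    by continuity. *)
Lemma pospart_curve {k l} (g : 'rV[R]_k -> 'rV[R]_l) z d e :
    differentiable g z -> nonpos (g z) ->
    (forall i, g z 0 i = 0 -> 'd g z d 0 i <= 0) -> 0 < e ->
  exists2 eta, 0 < eta & \forall t \near 0^'+, forall d', enorm (d' - d) <= eta ->
    enorm (pospart (g (z + t *: d'))) <= e * t.
Proof.
move=> dg gz gd e0.
pose e' := e / l.+1%:R; have e'0 : 0 < e' by rewrite divr_gt0.
have small i : exists2 eta, 0 < eta & \forall t \near 0^'+,
    forall d', enorm (d' - d) <= eta -> g (z + t *: d') 0 i <= e' * t.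
  have [eta eta0 Hexp] := hadamard_coord i d dg e'0; exists eta => //.
  have [gzi|gzi] := eqVneq (g z 0 i) 0.
    near=> t => d' d'd.
    have t0 : 0 < t by near: t; exact: nbhs_right_gt.
    have /(_ d' d'd) : forall h', enorm (h' - d) <= eta ->
      `|g (z + t *: h') 0 i - g z 0 i - t * 'd g z d 0 i| <= e' * t by near: t.
    rewrite gzi.
    have := gd i gzi; rewrite -(pmulr_rle0 _ t0) ler_norml; lra.
  have gzi0 : g z 0 i < 0 by rewrite lt_neqAle gzi gz.
  pose D := `|'d g z d 0 i| + 1.
  have D0 : 0 < D by rewrite ltr_wpDl.
  near=> t => d' d'd.
  have t0 : 0 < t by near: t; exact: nbhs_right_gt.
  have /(_ d' d'd) : forall h', enorm (h' - d) <= eta ->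
    `|g (z + t *: h') 0 i - g z 0 i - t * 'd g z d 0 i| <= e' * t by near: t.
  have : t * 'd g z d 0 i <= t * D.
    by rewrite ler_pM2l// /D (le_trans (ler_norm _))// lerDl.
  have : t * D <= - g z 0 i.
    rewrite -ler_pdivlMr//; near: t; apply: nbhs_right_le.
    by rewrite divr_gt0// oppr_gt0.
  rewrite ler_norml; lra.
have /choice[eta Heta] : forall i, exists eta, 0 < eta /\
    \forall t \near 0^'+,
    forall d', enorm (d' - d) <= eta -> g (z + t *: d') 0 i <= e' * t.
  by move=> i; have [eta ? ?] := small i; exists eta.
have {small} : \forall t \near 0^'+, forall i d', enorm (d' - d) <= eta i ->
    g (z + t *: d') 0 i <= e' * t.
  by apply: filter_forall => i; have [] := Heta i.
move=> small; exists (\big[Num.min/1]_i eta i).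
  by apply: lt_bigmin => // i _; have [] := Heta i.
near=> t => d' d'd.
have t0 : 0 < t by near: t; exact: nbhs_right_gt.
have e't : 0 <= e' * t by rewrite mulr_ge0// ltW.
have st : forall i d', enorm (d' - d) <= eta i -> g (z + t *: d') 0 i <= e' * t.
  by near: t.
rewrite (@le_trans _ _ (e' * t *+ l))//.
  rewrite (le_trans (enorm_le_sum _))//.
  rewrite -[X in _ *+ X](card_ord l) -sumr_const ler_sum// => i _.
  rewrite mxE ger0_norm ?le_max ?lexx ?orbT// ge_max e't andbT.
  by apply: st; apply: le_trans d'd _; exact: bigmin_le_cond.
rewrite -mulr_natr mulrAC ler_pM2r// /e' -mulrA ler_piMr ?(ltW e0)//.
by rewrite mulrC ler_pdivrMr// mul1r ler_nat.
Unshelve. all: by end_near. Qed.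

(** Metric subregularity turns the small violation of pospart_curve into a small
    distance to the feasible set, hence into a feasible curve tangent to [d]. *)
Lemma mscq_tangent {k l} (g : 'rV[R]_k -> 'rV[R]_l) z d e :
    differentiable g z -> MSCQ g z -> nonpos (g z) ->
    (forall i, g z 0 i = 0 -> 'd g z d 0 i <= 0) -> 0 < e ->
  \forall t \near 0^'+, exists2 d', enorm (d' - d) <= e &
    nonpos (g (z + t *: d')).
Proof.
move=> dg [eps [kap [eps0 kap0 Hkap]]] gz gd e0.
have e'0 : 0 < e / (2 * kap) by rewrite divr_gt0// mulr_gt0.
have [eta eta0 small] := pospart_curve dg gz gd e'0.
near=> t.
have t0 : 0 < t by near: t; exact: nbhs_right_gt.
have zeps : enorm (z + t *: d - z) < eps.
  rewrite addrAC subrr add0r enormZ gtr0_norm//.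
  rewrite (@le_lt_trans _ _ (t * (enorm d + 1)))//.
    by rewrite ler_pM2l// lerDl.
  rewrite -ltr_pdivlMr ?ltr_wpDl ?enorm_ge0//; near: t; apply: nbhs_right_lt.
  by rewrite divr_gt0// ltr_wpDl ?enorm_ge0.
have := Hkap _ zeps.
have pp : kap * enorm (pospart (g (z + t *: d))) < e * t.
  have /(_ d) : forall d', enorm (d' - d) <= eta ->
    enorm (pospart (g (z + t *: d'))) <= e / (2 * kap) * t by near: t.
  rewrite subrr enorm0 (ltW eta0) => /(_ isT).
  rewrite -(ler_pM2l kap0) => /le_lt_trans; apply.
  rewrite (_ : kap * _ = e * t / 2); last by field; rewrite gt_eqF.
  by have := mulr_gt0 e0 t0; lra.
move=> /le_lt_trans/(_ (pp : (_%:E < _%:E)%E)).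
move=> /ereal_inf_lt[_ [a ga <-]]; rewrite lte_fin => /ltW ale.
exists (t^-1 *: (a - z)).
  rewrite -(@ler_pM2r _ t)// (le_trans _ ale)// -[X in _ * X](gtr0_norm t0).
  rewrite mulrC -enormZ scalerBr scalerA divff ?gt_eqF// scale1r.
  by rewrite -addrA -opprD enormB.
by rewrite scalerA divff ?gt_eqF// scale1r addrCA subrr addr0.
Unshelve. all: by end_near. Qed.

(** Metric subregularity yields a tangent feasible curve whose first component is
    [x + t u] only up to [o(t)]; fiber_correction makes it exact, which is what
    allows the curve to be used as a competitor in the lower-level problem at
    [x + t u]. *)
Lemma feasible_curve {n m l} (g : 'rV[R]_(n + m) -> 'rV[R]_l) x y u v e :
    quasi_convex g -> differentiable g (row_mx x y) -> MSCQ g (row_mx x y) ->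
    nonpos (g (row_mx x y)) -> (\forall x' \near x, lower_feas g x' !=set0) ->
    (forall i, g (row_mx x y) 0 i = 0 ->
      'd g (row_mx x y) (row_mx u v) 0 i <= 0) -> 0 < e ->
  \forall t \near 0^'+, exists2 w, enorm (w - v) <= e &
    nonpos (g (row_mx x y + t *: row_mx u w)).
Proof.
move=> qc dg ms gz feas gd e0.
have [eta eta0 Hcor] :=
  fiber_correction u v (quasi_convex_segment qc) gz feas e0.
have Htan := mscq_tangent dg ms gz gd eta0.
near=> t.
have [d' d'd gd'] : exists2 d', enorm (d' - row_mx u v) <= eta &
  nonpos (g (row_mx x y + t *: d')) by near: t.
have Hc : forall u' v', enorm (u' - u) <= eta -> enorm (v' - v) <= eta ->
    nonpos (g (row_mx x y + t *: row_mx u' v')) ->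
    exists2 w, enorm (w - v) <= e & nonpos (g (row_mx x y + t *: row_mx u w)).
  by near: t.
apply: (Hc (lsubmx d') (rsubmx d')); last by rewrite hsubmxK.
  apply: le_trans d'd; rewrite -{2}(hsubmxK d') opp_row_mx add_row_mx.
  rewrite -(@ler_pXn2r _ 2)// ?nnegrE ?enorm_ge0// enorm_row_mx lerDl.
  exact: sqr_ge0.
apply: le_trans d'd; rewrite -{2}(hsubmxK d') opp_row_mx add_row_mx.
rewrite -(@ler_pXn2r _ 2)// ?nnegrE ?enorm_ge0// enorm_row_mx lerDr.
exact: sqr_ge0.
Unshelve. all: by end_near. Qed.

End ConvexSets.

(** * First-order consequences of convexity, and small steps *)

Section FirstOrder.
Context {R : realType}.

(** The gradient inequality for the convex function [f + rho/2 |.|^2], obtained by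
    letting the convexity inequality on the segment from [a] to [b] tend to [a];
    the linear part of the quadratic cancels. *)
Lemma weakly_convex_gradient {k} rho (D : set 'rV[R]_k) (f : 'rV[R]_k -> R) a b :
    weakly_convex rho D f -> differentiable f a -> D a -> D b -> 0 <= rho ->
  f a + 'd f a (b - a) - rho / 2 * enorm (b - a) ^+ 2 <= f b.
Proof.
move=> wc df Da Db rho0; apply/ler_addgt0Pr => e e0.
have [eta eta0 Hexp] := hadamard_expansion (b - a) df e0.
suff : \forall t \near (0 : R)^'+,
    f a + 'd f a (b - a) - rho / 2 * enorm (b - a) ^+ 2 <= f b + e.
  by move=> /filter_ex[].
near=> t.
have t0 : 0 < t by near: t; exact: nbhs_right_gt.
have t1 : t <= 1 by near: t; exact: nbhs_right_le.
have /(_ (b - a)) : forall h', enorm (h' - (b - a)) <= eta ->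
  `|f (a + t *: h') - f a - t * 'd f a (b - a)| <= e * t by near: t.
rewrite subrr enorm0 (ltW eta0) ler_norml => /(_ isT) H1.
have := convex_function_segment wc Da Db (ltW t0) t1.
have -> : enorm b ^+ 2 =
    enorm a ^+ 2 + 2 * dot a (b - a) + enorm (b - a) ^+ 2.
  have {1}-> : b = a + (b - a) by rewrite addrC subrK.
  move: (b - a) => w; rewrite !enorm_sqr dotDl !dotDr (dotC w a); ring.
move: H1; move: (b - a) => w H1.
rewrite !enorm_sqr dotDl !dotDr !dotZl !dotZr (dotC w a) => H2.
rewrite -(ler_pM2l t0); move: H1 H2.
move: (dot w w) (dotvv_ge0 w) => Q Q0 H1 H2.
have : 0 <= t * t * (rho / 2 * Q) by rewrite !mulr_ge0// ?ltW// invr_ge0.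
move: H1 H2; move: (f (a + _)) (f a) (f b) ('d f a _) (dot a a) (dot a w).
by move=> x1 x2 x3 x4 x5 x6; lra.
Unshelve. all: by end_near. Qed.

(** The zero sublevel set is convex, so [g i] is nonpositive on the segment that
    leaves its zero [a] towards [b]. *)
Lemma quasi_convex_gradient {k l} (g : 'rV[R]_k -> 'rV[R]_l) a b i :
    quasi_convex g -> differentiable g a -> nonpos (g a) -> nonpos (g b) ->
    g a 0 i = 0 -> 'd g a (b - a) 0 i <= 0.
Proof.
move=> qc dg ga gb gai; apply/ler_addgt0Pr => e e0; rewrite add0r.
have [eta eta0 Hexp] := hadamard_coord i (b - a) dg e0.
suff : \forall t \near (0 : R)^'+, 'd g a (b - a) 0 i <= e by move=> /filter_ex[].
near=> t.
have t0 : 0 < t by near: t; exact: nbhs_right_gt.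
have t1 : t <= 1 by near: t; exact: nbhs_right_le.
have /(_ (b - a)) : forall h', enorm (h' - (b - a)) <= eta ->
  `|g (a + t *: h') 0 i - g a 0 i - t * 'd g a (b - a) 0 i| <= e * t by near: t.
rewrite subrr enorm0 (ltW eta0) ler_norml gai => /(_ isT) H1.
have := quasi_convex_segment qc ga gb (ltW t0) t1 => /(_ i) H2.
rewrite -(ler_pM2l t0); lra.
Unshelve. all: by end_near. Qed.

Lemma limf_esup_at_right_le (h : R -> \bar R) (c : \bar R) :
  (\forall t \near 0^'+, (h t <= c)%E) -> (limf_esup h (0 : R)^'+ <= c)%E.
Proof.
move=> Hh; apply: (@le_trans _ _ (ereal_sup (h @` [set t | (h t <= c)%E]))).
  by apply: ereal_inf_lbound; exists [set t | (h t <= c)%E].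
by apply: ge_ereal_sup => _ [t ht <-].
Qed.

Lemma limf_esup_at_right_ge (h : R -> \bar R) (c : \bar R) :
  (\forall t \near 0^'+, (c <= h t)%E) -> (c <= limf_esup h (0 : R)^'+)%E.
Proof.
move=> Hh; apply: le_ereal_inf_tmp => _ [V FV <-].
have [t [Vt ct]] := filter_ex (filterI FV Hh).
by apply: (le_trans ct); apply: ereal_sup_ubound; exists t.
Qed.

(** A constraint that is strictly satisfied by [d] survives a small step in any
    direction, so only the constraints that vanish at [d] restrict [h]. *)
Lemma linear_step {V : lmodType R} {l} (L : {linear V -> 'rV[R]_l})
    (P : pred 'I_l) d h :
    (forall i, P i -> L d 0 i <= 0) ->
    (forall i, P i -> L d 0 i = 0 -> L h 0 i <= 0) ->
  \forall s \near 0^'+, forall i, P i -> L (d + s *: h) 0 i <= 0.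
Proof.
move=> Ld Lh; apply: filter_forall => i.
have [Pi|Pi] := boolP (P i); last by near=> s.
have [Ldi|Ldi] := eqVneq (L d 0 i) 0.
  near=> s => _.
  have s0 : 0 < s by near: s; exact: nbhs_right_gt.
  by rewrite linearD linearZ/= !mxE Ldi add0r pmulr_rle0// Lh.
have Ldi0 : L d 0 i < 0 by rewrite lt_neqAle Ldi Ld.
near=> s => _.
have s0 : 0 < s by near: s; exact: nbhs_right_gt.
rewrite linearD linearZ/= !mxE.
have : s * (`|L h 0 i| + 1) <= - L d 0 i.
  rewrite -ler_pdivlMr ?ltr_wpDl//; near: s; apply: nbhs_right_le.
  by rewrite divr_gt0 ?oppr_gt0// ltr_wpDl.
have : s * L h 0 i <= s * (`|L h 0 i| + 1).
  by rewrite ler_pM2l// (le_trans (ler_norm _))// lerDl.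
lra.
Unshelve. all: by end_near. Qed.

(** Curves tangent to [d] eventually enter every directional neighbourhood of [d]:
    the angular condition does not change under scaling by [t], and it holds once
    [d'] is close to [d]. *)
Lemma dir_nbhd_curve {k} eps delta (d : 'rV[R]_k) : 0 < eps -> 0 < delta ->
  exists2 eta, 0 < eta & \forall t \near 0^'+, forall d', enorm (d' - d) <= eta ->
    dir_nbhd eps delta d (t *: d').
Proof.
move=> eps0 del0.
(* The first term solves 2 eta = delta (|d| - eta); the second one only makes
   eta positive when d = 0, where the angular condition is void. *)
pose eta := delta * enorm d / (2 + delta) + (enorm d == 0)%:R.
have d2 : 0 < 2 + delta by lra.
have N0 := enorm_ge0 d.
have etaE : enorm d != 0 -> eta = delta * enorm d / (2 + delta).
  by rewrite /eta; case: eqVneq => // _ _; rewrite addr0.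
have eta0 : 0 < eta.
  have [d0|d0] := eqVneq (enorm d) 0.
    by rewrite /eta d0 eqxx mulr0 mul0r add0r.
  by rewrite etaE// divr_gt0// mulr_gt0// lt_neqAle eq_sym d0.
have M0 : 0 < enorm d + eta by exact: ltr_wpDl.
exists eta => //; near=> t => d' d'd.
have t0 : 0 < t by near: t; exact: nbhs_right_gt.
have d'M : enorm d' <= enorm d + eta.
  by rewrite -[d'](subrK d) (le_trans (enormD _ _))// addrC lerD2l.
split.
  rewrite enormZ gtr0_norm// (@le_lt_trans _ _ (t * (enorm d + eta)))//.
    by rewrite ler_pM2l.
  rewrite -ltr_pdivlMr//; near: t; apply: nbhs_right_lt.
  by rewrite divr_gt0.
rewrite enormZ gtr0_norm//.
have -> : enorm d *: (t *: d') - (t * enorm d') *: d =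
    t *: (enorm d *: (d' - d) + (enorm d - enorm d') *: d).
  rewrite !scalerA (mulrC (enorm d)) -!scalerA -scalerBr; congr (_ *: _).
  by rewrite scalerBr scalerBl addrA subrK.
rewrite enormZ gtr0_norm// mulrCA -!mulrA ler_pM2l//.
rewrite (le_trans (enormD _ _))// !enormZ (ger0_norm N0).
have nd : `|enorm d - enorm d'| <= enorm (d' - d).
  by rewrite (le_trans (ler_enorm_norm _ _))// enormB.
have [d0|d0] := eqVneq (enorm d) 0; first by rewrite d0 !(mulr0, mul0r) addr0.
have dp : 0 < enorm d by rewrite lt_neqAle eq_sym d0.
rewrite mulrC -mulrDl mulrA ler_pM2r//.
rewrite (@le_trans _ _ (2 * eta))//.
  by have := le_trans nd d'd; lra.
have : delta * (enorm d - eta) <= delta * enorm d'.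
  by rewrite ler_pM2l//; move: nd; rewrite ler_norml; lra.
apply: le_trans.
have : eta * (2 + delta) = delta * enorm d by rewrite etaE// divfK// gt_eqF.
lra.
Unshelve. all: by end_near. Qed.

Lemma jacTE {k l} (g : 'rV[R]_k -> 'rV[R]_l) z lam i :
  jacT g z lam 0 i = dot lam ('d g z (delta_mx 0 i)).
Proof. by rewrite /jacT /jacobian mxE; apply: eq_bigr => j _; rewrite !mxE. Qed.

Lemma lin_form_coord {V : lmodType R} {l} (L : {linear V -> 'rV[R]_l}) i :
  lin_form (fun h => L h 0 i).
Proof. by move=> s x y; rewrite linearP !mxE. Qed.

Lemma dot_supp {l} (lam a : 'rV[R]_l) : nonneg lam ->
  (forall i, lam 0 i != 0 -> a 0 i <= 0) -> dot lam a <= 0.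
Proof.
move=> l0 la; apply: sumr_le0 => i _.
have [->|li] := eqVneq (lam 0 i) 0; first by rewrite mul0r.
by rewrite mulr_ge0_le0// la.
Qed.

Lemma complementary_supp {l} (lam a : 'rV[R]_l) i :
  nonneg lam -> nonpos a -> dot a lam = 0 -> lam 0 i != 0 -> a 0 i = 0.
Proof.
move=> l0 a0 al li; apply/eqP; rewrite -(mulIr_eq0 _ (mulIf li)) -oppr_eq0.
have : \sum_j - (a 0 j * lam 0 j) = 0 by rewrite sumrN -/(dot a lam) al oppr0.
move/eqP; rewrite psumr_eq0; first by move=> /allP/(_ i (mem_index_enum _)).
by move=> j _; rewrite oppr_ge0 mulr_le0_ge0.
Qed.

End FirstOrder.

Lemma farkas_pair {R : realType} {V : lmodType R} {k l : nat}
    (L : {linear V -> 'rV[R]_k}) (M : {linear V -> 'rV[R]_l})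
    (P : pred 'I_k) (Q : pred 'I_l) (b : V -> R) :
    lin_form b ->
    (forall h, (forall i, P i -> L h 0 i <= 0) ->
      (forall j, Q j -> M h 0 j <= 0) -> 0 <= b h) ->
  exists lam : 'rV[R]_k, exists mu : 'rV[R]_l,
    [/\ nonneg lam, nonneg mu, (forall i, ~~ P i -> lam 0 i = 0),
        (forall j, ~~ Q j -> mu 0 j = 0) &
        forall h, 0 = b h + dot lam (L h) + dot mu (M h)].
Proof.
move=> lb H.
pose a (i : 'I_k + 'I_l) h :=
  match i with inl i => L h 0 i | inr j => M h 0 j end.
pose PQ (i : 'I_k + 'I_l) := match i with inl i => P i | inr j => Q j end.
have [||h Hh|c [c0 cPQ bE]] := @farkas R V _ PQ a (fun h => - b h).
- by case=> i; exact: lin_form_coord.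
- by move=> s x y; rewrite lb opprD mulrN.
- rewrite oppr_le0; apply: H => i Pi; first exact: (Hh (inl i)).
  exact: (Hh (inr i)).
exists (\row_i c (inl i)), (\row_j c (inr j)); split.
- by move=> i; rewrite mxE.
- by move=> i; rewrite mxE.
- by move=> i Pi; rewrite mxE; exact: cPQ.
- by move=> i Pi; rewrite mxE; exact: cPQ.
move=> h; have := bE h; rewrite big_sumType/= => E.
rewrite -addrA [X in _ + X](_ : _ = - b h) ?subrr// E.
by congr (_ + _); apply: eq_bigr => i _; rewrite mxE.
Qed.

Lemma dot_supp_eq0 {R : realType} {l} (lam a : 'rV[R]_l) :
  (forall i, a 0 i != 0 -> lam 0 i = 0) -> dot lam a = 0.
Proof.
move=> H; apply: big1 => i _.
by have [->|/H ->] := eqVneq (a 0 i) 0; rewrite ?mulr0 ?mul0r.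
Qed.

(** * Multipliers of the lower level and the Moreau envelope *)

Section LowerLevel.
Context {R : realType} {n m p : nat}.
Variables (f : 'rV[R]_(n + m) -> R) (g : 'rV[R]_(n + m) -> 'rV[R]_p).
Variables (xb : 'rV[R]_n) (yb : 'rV[R]_m).
Let zb := row_mx xb yb.
Hypotheses (f_diff : differentiable f zb) (g_diff : differentiable g zb).

(** The partial differential in [x] of the Lagrangian, applied to [u]. *)
Definition lagr_slope (lam : 'rV[R]_p) (u : 'rV[R]_n) : R :=
  'd f zb (row_mx u 0) + dot ('d g zb (row_mx u 0)) lam.

Lemma lagrangian_diff lam :
  is_diff zb (fun z => f z + dot (g z) lam)
    (fun h => 'd f zb h + dot ('d g zb h) lam).
Proof.
have [dl dlE] := dot_diff lam g_diff.
apply: DiffDef; first exact: (@differentiableD _ _ _ f (fun z => dot (g z) lam)).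
rewrite (@diffD _ _ _ f (fun z => dot (g z) lam) zb f_diff dl).
by apply/funext => h; have /= <- := congr1 (fun k => k h) dlE.
Qed.

Lemma lagr_slopeE lam u :
  'd (fun x => lagr f g x yb lam) xb u = lagr_slope lam u.
Proof.
have [dl dlE] := lagrangian_diff lam.
have [_ dE] :=
  @partial_left_diff _ _ _ _ (fun z => f z + dot (g z) lam) xb yb dl.
have /= -> := congr1 (fun k => k u) dE.
by have /= -> := congr1 (fun k => k (row_mx u 0)) dlE.
Qed.

Lemma grad_lagrE lam : grad (fun y => lagr f g xb y lam) yb = 0 <->
  forall v, 'd f zb (row_mx 0 v) + dot ('d g zb (row_mx 0 v)) lam = 0.
Proof.
have [dl dlE] := lagrangian_diff lam.
have [_ dE] :=
  @partial_right_diff _ _ _ _ (fun z => f z + dot (g z) lam) xb yb dl.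
have E v : 'd (fun y => lagr f g xb y lam) yb v =
    'd f zb (row_mx 0 v) + dot ('d g zb (row_mx 0 v)) lam.
  have /= -> := congr1 (fun k => k v) dE.
  by have /= -> := congr1 (fun k => k (row_mx 0 v)) dlE.
split=> [/rowP H v|H].
  rewrite -E {1}(row_sum_delta v) linear_sum big1// => i _.
  by rewrite linearZ/=; have := H i; rewrite !mxE => ->; rewrite scaler0.
by apply/rowP => i; rewrite !mxE E H.
Qed.

Lemma multipliersP lam : multipliers f g xb yb lam <->
  [/\ nonneg lam,
      forall v, 'd f zb (row_mx 0 v) + dot ('d g zb (row_mx 0 v)) lam = 0 &
      dot (g zb) lam = 0].
Proof. by split=> -[? /grad_lagrE ? ?]. Qed.

(** Stationarity in [y] makes the second component [v] irrelevant for the full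
    differential of the Lagrangian. *)
Lemma lagr_slope_split lam u v : multipliers f g xb yb lam ->
  lagr_slope lam u = 'd f zb (row_mx u v) + dot ('d g zb (row_mx u v)) lam.
Proof.
move=> /multipliersP[_ /(_ v) H _].
rewrite -[LHS]addr0 -H /lagr_slope addrACA -linearD -dotDl -linearD.
by rewrite add_row_mx addr0 add0r.
Qed.

Lemma multiplier_active lam i : nonpos (g zb) -> multipliers f g xb yb lam ->
  lam 0 i != 0 -> g zb 0 i = 0.
Proof. by move=> gz /multipliersP[? _ ?]; exact: complementary_supp. Qed.

Lemma dot_multiplier_le0 lam d : nonpos (g zb) -> multipliers f g xb yb lam ->
  (forall i, g zb 0 i = 0 -> 'd g zb d 0 i <= 0) -> dot ('d g zb d) lam <= 0.
Proof.
move=> gz lm gd; rewrite dotC; apply: dot_supp; first by case: lm.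
by move=> i /(multiplier_active gz lm); exact: gd.
Qed.

(** Linear programming duality in the form needed here: the hypothesis says that
    [v] minimizes the linearized lower-level objective over the linearized
    feasible set, and the multiplier comes from the constraints active at that
    minimizer. *)
Lemma dir_multiplier_exists u v : nonpos (g zb) ->
    (forall i, g zb 0 i = 0 -> 'd g zb (row_mx u v) 0 i <= 0) ->
    (forall w, (forall i, g zb 0 i = 0 -> 'd g zb (row_mx u w) 0 i <= 0) ->
      'd f zb (row_mx u v) <= 'd f zb (row_mx u w)) ->
  exists lam, dir_multipliers f g xb yb u v lam.
Proof.
move=> gz gd vmin.
pose P i := (g zb 0 i == 0) && ('d g zb (row_mx u v) 0 i == 0).
have uE s w : row_mx u v + s *: row_mx 0 w = row_mx u (v + s *: w).
  by rewrite scale_row_mx add_row_mx scaler0 addr0.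
have [||h Hh|l [l0 lP lE]] := @farkas R 'rV[R]_m 'I_p P
    (fun i h => 'd g zb (row_mx 0 h) 0 i) (fun h => - 'd f zb (row_mx 0 h)).
- by move=> i s x y; rewrite row_0mx_linear; exact: lin_form_coord.
- by move=> s x y; rewrite row_0mx_linear linearP opprD -mulrN.
- have Hs : \forall s \near 0^'+, forall i, g zb 0 i == 0 ->
      'd g zb (row_mx u v + s *: row_mx 0 h) 0 i <= 0.
    apply: linear_step => i /eqP gi; first exact: gd.
    by move=> /eqP di; apply: Hh; rewrite /P gi eqxx.
  have [s [s0 {}Hs]] := filter_ex (filterI (nbhs_right_gt (0 : R)) Hs).
  have := vmin (v + s *: h); rewrite -uE => /(_ _)/wrap[].
    by move=> i /eqP; exact: Hs.
  by rewrite linearD linearZ/= lerDl pmulr_rge0// oppr_le0.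
exists (\row_i l i).
have lE' v' :
    'd f zb (row_mx 0 v') + dot ('d g zb (row_mx 0 v')) (\row_i l i) = 0.
  apply/eqP; rewrite addrC -[X in _ + X]opprK subr_eq0 lE; apply/eqP.
  by apply: eq_bigr => i _; rewrite mxE mulrC.
have l00 : nonneg (\row_i l i) by move=> i; rewrite mxE.
split; last first.
  apply: big1 => i _; rewrite mxE.
  have [/andP[_ /eqP ->]|/lP ->] := boolP (P i); first by rewrite mulr0.
  by rewrite mul0r.
apply/multipliersP; split=> //.
apply: big1 => i _; rewrite mxE.
have [/andP[/eqP -> _]|/lP ->] := boolP (P i); first by rewrite mul0r.
by rewrite mulr0.
Qed.

Section Envelope.
Variables (rho gam : R).
Hypotheses (gz : nonpos (g zb)) (g_qc : quasi_convex g) (rho0 : 0 < rho)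
  (f_wc : weakly_convex rho (gph_lower g) f) (gam0 : 0 < gam)
  (gamlt : gam < 1 / rho).

Lemma gph_lowerE z : gph_lower g z = nonpos (g z).
Proof. by rewrite /gph_lower/= /lower_feas/= hsubmxK. Qed.

(** Adding the multiplier part to the gradient inequality of [f] costs nothing on
    the feasible set, since by quasi-convexity no active constraint increases to
    first order towards a feasible point;
    the Lagrangian slope then depends on [x] only. *)
Lemma lower_level_minorant lam x w : multipliers f g xb yb lam ->
    lower_feas g x w ->
  f zb + lagr_slope lam (x - xb) -
    rho / 2 * (enorm (x - xb) ^+ 2 + enorm (w - yb) ^+ 2) <= f (row_mx x w).
Proof.
move=> lm gw; rewrite -enorm_row_mx.
have zE : row_mx (x - xb) (w - yb) = row_mx x w - zb.
  by rewrite opp_row_mx add_row_mx.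
rewrite (lagr_slope_split (x - xb) (w - yb) lm) zE.
have Dz : gph_lower g zb by rewrite gph_lowerE.
have Dw : gph_lower g (row_mx x w) by rewrite gph_lowerE.
have := weakly_convex_gradient f_wc f_diff Dz Dw (ltW rho0).
apply: le_trans; rewrite lerB// lerD2l gerDl.
apply: dot_multiplier_le0 => // i gi.
exact: quasi_convex_gradient.
Qed.

(** The proximal term outweighs the concavity of [f] exactly because
    [1 / gam > rho]; what remains after minimizing over [a] is quadratic in
    [b]. *)
Lemma prox_absorbs {k} : exists2 c, 0 <= c & forall a b : 'rV[R]_k,
  - (c * enorm b ^+ 2) <=
    (2 * gam)^-1 * enorm (a - b) ^+ 2 - rho / 2 * enorm a ^+ 2.
Proof.
have D : 0 < 1 - gam * rho by rewrite subr_gt0 -ltr_pdivlMr.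
exists (rho / (2 * (1 - gam * rho))).
  by rewrite divr_ge0 ?(ltW rho0)// mulr_ge0// ltW.
move=> a b; rewrite -subr_ge0.
have H : 0 <= (1 - gam * rho) ^+ 2 * dot a a - 2 * (1 - gam * rho) * dot a b
    + dot b b.
  have := dotvv_ge0 ((1 - gam * rho) *: a + (-1) *: b).
  rewrite !(dotDl, dotDr, dotZl, dotZr) (dotC b a); congr (_ <= _); ring.
have -> : enorm (a - b) ^+ 2 = dot a a - 2 * dot a b + dot b b.
  rewrite enorm_sqr -scaleN1r !(dotDl, dotDr, dotZl, dotZr) (dotC b a); ring.
rewrite !enorm_sqr; move: H.
move: (dot a a) (dot a b) (dot b b) => x y z H.
rewrite (_ : _ - _ = ((1 - gam * rho) ^+ 2 * x - 2 * (1 - gam * rho) * y + z)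
   / (2 * gam * (1 - gam * rho))).
  by rewrite divr_ge0// !mulr_ge0// ltW.
by field; rewrite !gt_eqF.
Qed.

(** The quadratic loss in lower_level_minorant is absorbed by the proximal term
    for every lower-level candidate, so each multiplier provides a minorant of
    the envelope that touches it at the reference point. *)
Lemma moreau_lower : exists2 c, 0 <= c & forall lam z,
  multipliers f g xb yb lam ->
  ((f zb + lagr_slope lam (lsubmx z - xb) - c * enorm (z - zb) ^+ 2)%:E
     <= moreau_pair f g gam z)%E.
Proof.
have [c c0 Hc] := @prox_absorbs m.
exists (c + rho / 2); first by rewrite addr_ge0// divr_ge0// ltW.
move=> lam z lm; apply: le_ereal_inf_tmp => _ [w gw <-]; rewrite lee_fin.
have := lower_level_minorant lm gw.
have := Hc (w - yb) (rsubmx z - yb).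
rewrite opprB addrA subrK.
have -> : enorm (z - zb) ^+ 2 =
    enorm (lsubmx z - xb) ^+ 2 + enorm (rsubmx z - yb) ^+ 2.
  by rewrite -enorm_row_mx -{1}(hsubmxK z) opp_row_mx add_row_mx.
have := mulr_ge0 c0 (sqr_ge0 (enorm (lsubmx z - xb))).
have := mulr_ge0 (ltW rho0) (sqr_ge0 (enorm (rsubmx z - yb))).
lra.
Qed.

Lemma moreau_le x y w : lower_feas g x w ->
  (moreau f g gam x y <=
    (f (row_mx x w) + (2 * gam)^-1 * enorm (w - y) ^+ 2)%:E)%E.
Proof. by move=> gw; apply: ereal_inf_lbound; exists w. Qed.

(** The feasible curve with direction [(u, w)] is a competitor in the infimum
    defining the envelope; its proximal cost is of order [t^2], so [v] does not
    appear on the right. *)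
Lemma moreau_upper u v w e : MSCQ g zb ->
    (\forall x \near xb, lower_feas g x !=set0) ->
    (forall i, g zb 0 i = 0 -> 'd g zb (row_mx u w) 0 i <= 0) -> 0 < e ->
  \forall t \near 0^'+, (moreau_pair f g gam (zb + t *: row_mx u v) <=
    (f zb + t * ('d f zb (row_mx u w) + e))%:E)%E.
Proof.
move=> ms feas gd e0.
have e20 : 0 < e / 2 by rewrite divr_gt0.
have [eta eta0 Hf] := hadamard_expansion (row_mx u w) f_diff e20.
have Hg := feasible_curve g_qc g_diff ms gz feas gd eta0.
pose K := (2 * gam)^-1 * (eta + enorm (w - v)) ^+ 2.
have K0 : 0 < K.
  apply: mulr_gt0; first by rewrite invr_gt0 mulr_gt0.
  by apply: exprn_gt0; rewrite ltr_pwDl// enorm_ge0.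
near=> t.
have t0 : 0 < t by near: t; exact: nbhs_right_gt.
have tK : t * K <= e / 2.
  by rewrite -ler_pdivlMr//; near: t; apply: nbhs_right_le; rewrite divr_gt0.
have [w' w'w gw'] : exists2 w', enorm (w' - w) <= eta &
  nonpos (g (zb + t *: row_mx u w')) by near: t.
have /(_ (row_mx u w')) : forall h', enorm (h' - row_mx u w) <= eta ->
  `|f (zb + t *: h') - f zb - t * 'd f zb (row_mx u w)| <= e / 2 * t by near: t.
rewrite opp_row_mx add_row_mx subrr enorm_row0mx => /(_ w'w).
have E w1 : zb + t *: row_mx u w1 = row_mx (xb + t *: u) (yb + t *: w1).
  by rewrite scale_row_mx add_row_mx.
rewrite !E in gw' *.
move=> Hfw; rewrite /moreau_pair row_mxKl row_mxKr.
apply: le_trans (moreau_le _ gw') _; rewrite lee_fin.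
have -> : yb + t *: w' - (yb + t *: v) = t *: (w' - v).
  by rewrite opprD addrACA subrr add0r scalerBr.
rewrite enormZ gtr0_norm// exprMn.
have : (2 * gam)^-1 * (t ^+ 2 * enorm (w' - v) ^+ 2) <= t * (t * K).
  rewrite (_ : t * _ = (2 * gam)^-1 * (t ^+ 2 * (eta + enorm (w - v)) ^+ 2)).
    rewrite ler_wpM2l ?invr_ge0 ?mulr_ge0 ?(ltW gam0)// ler_wpM2l ?sqr_ge0//.
    rewrite ler_pXn2r ?nnegrE ?enorm_ge0 ?addr_ge0 ?enorm_ge0 ?(ltW eta0)//.
    have -> : w' - v = (w' - w) + (w - v) by rewrite addrA subrK.
    by rewrite (le_trans (enormD _ _))// lerD2r.
  by rewrite /K; ring.
have : t * (t * K) <= t * (e / 2) by rewrite ler_pM2l.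
move: Hfw; rewrite ler_norml; lra.
Unshelve. all: by end_near. Qed.

Hypothesis moreau_zb : moreau_pair f g gam zb = (f zb)%:E.

Lemma upper_dir_deriv_le u v w : MSCQ g zb ->
    (\forall x \near xb, lower_feas g x !=set0) ->
    (forall i, g zb 0 i = 0 -> 'd g zb (row_mx u w) 0 i <= 0) ->
  (upper_dir_deriv (moreau_pair f g gam) zb (row_mx u v)
     <= ('d f zb (row_mx u w))%:E)%E.
Proof.
move=> ms feas gd; apply/lee_addgt0Pr => e e0.
apply: limf_esup_at_right_le.
have Hm := moreau_upper v ms feas gd e0.
near=> t.
have t0 : 0 < t by near: t; exact: nbhs_right_gt.
rewrite moreau_zb lee_pdivrMr// leeBlDr// -EFinD.
rewrite [_ * t]mulrC [_ + f zb]addrC; near: t; exact: Hm.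
Unshelve. all: by end_near. Qed.

Lemma upper_dir_deriv_ge lam d : multipliers f g xb yb lam ->
  ((lagr_slope lam (lsubmx d))%:E
     <= upper_dir_deriv (moreau_pair f g gam) zb d)%E.
Proof.
move=> lm; have [c c0 Hc] := moreau_lower.
apply/lee_subgt0Pr => e e0.
apply: limf_esup_at_right_ge.
near=> t.
have t0 : 0 < t by near: t; exact: nbhs_right_gt.
rewrite moreau_zb lee_pdivlMr// leeBrDr// -EFinD.
apply: le_trans (Hc lam (zb + t *: d) lm); rewrite lee_fin.
have -> : lsubmx (zb + t *: d) - xb = t *: lsubmx d.
  by rewrite linearD linearZ/= row_mxKl addrAC subrr add0r.
have -> : lagr_slope lam (t *: lsubmx d) = t * lagr_slope lam (lsubmx d).
  rewrite /lagr_slope.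
  have -> : row_mx (t *: lsubmx d) 0 = t *: row_mx (lsubmx d) 0 :> 'rV[R]_(n + m).
    by rewrite scale_row_mx scaler0.
  by rewrite !linearZ/= dotZl mulrDr.
have -> : zb + t *: d - zb = t *: d by rewrite addrAC subrr add0r.
rewrite enormZ gtr0_norm// exprMn.
have tc : t * (c * enorm d ^+ 2 + 1) <= e.
  rewrite -ler_pdivlMr; last by rewrite ltr_wpDl// mulr_ge0// sqr_ge0.
  near: t; apply: nbhs_right_le; rewrite divr_gt0//.
  by rewrite ltr_wpDl// mulr_ge0// sqr_ge0.
have : t * (t * (c * enorm d ^+ 2 + 1)) <= t * e by rewrite ler_pM2l.
have := mulr_ge0 (ltW t0) (ltW t0).
lra.
Unshelve. all: by end_near. Qed.

End Envelope.
End LowerLevel.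

(** * Critical cone and partial calmness *)

Section ValueProgram.
Context {R : realType} {n m p q : nat}.
Variables (F f : 'rV[R]_(n + m) -> R) (g : 'rV[R]_(n + m) -> 'rV[R]_p)
  (G : 'rV[R]_(n + m) -> 'rV[R]_q) (rho gam : R)
  (xb : 'rV[R]_n) (yb : 'rV[R]_m).
Let zb := row_mx xb yb.
Hypotheses (F_diff : differentiable F zb) (f_diff : differentiable f zb)
  (g_diff : differentiable g zb) (G_diff : differentiable G zb)
  (g_qc : quasi_convex g) (rho0 : 0 < rho)
  (f_wc : weakly_convex rho (gph_lower g) f)
  (gam0 : 0 < gam) (gamlt : gam < 1 / rho)
  (zb_feas : VP_feas f g G gam zb)
  (feas : \forall x \near xb, lower_feas g x !=set0) (ms : MSCQ g zb).

Let gz : nonpos (g zb). Proof. by case: zb_feas. Qed.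
Let Gz : nonpos (G zb). Proof. by case: zb_feas. Qed.

Lemma moreau_at_feasible : moreau_pair f g gam zb = (f zb)%:E.
Proof.
apply/eqP; rewrite eq_le; apply/andP; split.
  rewrite /moreau_pair row_mxKl row_mxKr.
  have := @moreau_le R n m p f g gam xb yb yb gz.
  by rewrite subrr enorm0 expr0n mulr0 addr0.
case: zb_feas => + _ _.
case: (moreau_pair f g gam zb) => [r| |]//=; last by rewrite leey.
by rewrite -EFinB !lee_fin subr_le0.
Qed.

(** Criticality forces [v] to minimize the linearized lower-level objective, since
    the derivative of the envelope is below its value at every linearized feasible
    [w]. *)
Lemma critical_dir_multiplier u v :
    critical_cone F f g G gam zb (row_mx u v) ->
  exists lam, dir_multipliers f g xb yb u v lam.
Proof.
move=> [dv dF gd Gd]; apply: dir_multiplier_exists => // w gw.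
rewrite -lee_fin (le_trans dv)//.
apply: upper_dir_deriv_le => //; exact: moreau_at_feasible.
Qed.

(** On the critical cone the upper derivative of the envelope is at most the value
    of the linearized lower-level problem, which [v] therefore attains; duality
    then produces the maximizing multiplier. Conversely, a maximizing multiplier
    is one of the slopes bounding the upper derivative from below. *)
Lemma critical_coneE : critical_cone F f g G gam zb =
  [set d | [/\ is_max [set 'd (fun x => lagr f g x yb lam) xb (lsubmx d)
                      | lam in multipliers f g xb yb] ('d f zb d),
               'd F zb d <= 0,
               forall i, g zb 0 i = 0 -> 'd g zb d 0 i <= 0
             & forall i, G zb 0 i = 0 -> 'd G zb d 0 i <= 0]].
Proof.
apply/seteqP; split=> d.
  move=> cd; have [_ dF gd Gd] := cd; split=> //.
  have split_d lam : multipliers f g xb yb lam ->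
      lagr_slope f g xb yb lam (lsubmx d) = 'd f zb d + dot ('d g zb d) lam.
    move=> lm.
    by rewrite (lagr_slope_split f_diff g_diff _ (rsubmx d) lm) hsubmxK.
  rewrite -(hsubmxK d) in cd; have [lam [lm l0]] := critical_dir_multiplier cd.
  split.
    exists lam => //; rewrite (lagr_slopeE f_diff g_diff) split_d//.
    by rewrite dotC -[in dot _ _](hsubmxK d) l0 addr0.
  move=> _ [mu mm <-]; rewrite (lagr_slopeE f_diff g_diff) split_d//.
  by rewrite gerDl; exact: (dot_multiplier_le0 f_diff g_diff gz mm gd).
move=> [[[lam lm lE] _] dF gd Gd]; split=> //.
rewrite -lE (lagr_slopeE f_diff g_diff).
exact: (upper_dir_deriv_ge f_diff g_diff gz g_qc rho0 f_wc gam0 gamlt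
  moreau_at_feasible).
Qed.

(** Test partial calmness on a feasible curve tangent to [d + s h], for a fixed
    small [s]. The value-function constraint is violated there by at most
    [- t s dot (dg h) lam] up to [o(t)], by the minorant attached to [lam], and
    the constraint [G] by [o(t)]. Dividing by [t], and then by [s] thanks to
    ['d F zb d <= 0], leaves the stated inequality, with the calmness modulus as
    multiplier. *)
Lemma partially_calm_penalty u v lam :
    critical_cone F f g G gam zb (row_mx u v) ->
    dir_multipliers f g xb yb u v lam ->
    partially_calm F f g G gam zb (row_mx u v) ->
  exists2 al, 0 <= al & forall h,
    (forall i, g zb 0 i = 0 -> 'd g zb (row_mx u v) 0 i = 0 ->
      'd g zb h 0 i <= 0) ->
    (forall i, G zb 0 i = 0 -> 'd G zb (row_mx u v) 0 i = 0 ->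
      'd G zb h 0 i <= 0) ->
    0 <= 'd F zb h - al * dot ('d g zb h) lam.
Proof.
set d := row_mx u v => -[_ dF gd Gd] [lm l0].
move=> [eps [del [al [eps0 del0 al0 calm]]]].
exists al; first exact: ltW.
move=> h gh Gh.
have [eta1 eta10 Hdir] := dir_nbhd_curve d eps0 del0.
have Hg : \forall s \near 0^'+, forall i, g zb 0 i == 0 ->
    'd g zb (d + s *: h) 0 i <= 0.
  by apply: linear_step => i /eqP; [exact: gd | exact: gh].
have HG : \forall s \near 0^'+, forall i, G zb 0 i == 0 ->
    'd G zb (d + s *: h) 0 i <= 0.
  by apply: linear_step => i /eqP; [exact: Gd | exact: Gh].
have Hs : \forall s \near (0 : R)^'+, s * (enorm h + 1) <= eta1 / 2.
  have h1 : 0 < enorm h + 1 by rewrite ltr_wpDl// enorm_ge0.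
  near=> s; rewrite -ler_pdivlMr//; near: s; apply: nbhs_right_le.
  by rewrite !divr_gt0.
have [s [s0 [gds [Gds hs]]]] := filter_ex (filterI (nbhs_right_gt (0 : R))
  (filterI Hg (filterI HG Hs))).
set ds := d + s *: h in gds Gds.
pose us := lsubmx ds; pose vs := rsubmx ds.
have dsE : row_mx us vs = ds by rewrite hsubmxK.
(* th bounds from above the rate at which f minus the envelope grows along the
   curve. *)
pose th := - (s * dot ('d g zb h) lam).
have thE : dot ('d g zb ds) lam = - th.
  by rewrite /ds linearD linearZ/= dotDl dotZl dotC l0 add0r /th opprK.
have th0 : 0 <= th.
  rewrite -oppr_le0 -thE; apply: (dot_multiplier_le0 f_diff g_diff gz lm).
  by move=> i /eqP; exact: gds.
(* e bounds each of the o(t) errors: one for F, two for the value-function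
   constraint, one for G. *)
suff main e : 0 < e ->
    0 <= 'd F zb ds + e + al * (th + 2 * e + e).
  have dFs : 0 <= 'd F zb ds + al * th.
    apply/ler_addgt0Pr => e e0.
    have a3 : 0 < 1 + al * 3 by rewrite ltr_pwDl// mulr_ge0// ltW.
    have := main (e / (1 + al * 3)); rewrite divr_gt0// => /(_ isT).
    by congr (_ <= _); field; rewrite gt_eqF.
  rewrite -(pmulr_rge0 _ s0); apply: le_trans dFs _.
  have -> : 'd F zb ds = 'd F zb d + s * 'd F zb h.
    by rewrite /ds linearD linearZ.
  by rewrite /th; lra.
move=> e0.
have [eta2 eta20 HF] := hadamard_expansion ds F_diff e0.
have [eta3 eta30 Hf] := hadamard_expansion ds f_diff e0.
have Gds' i : G zb 0 i = 0 -> 'd G zb ds 0 i <= 0 by move=> /eqP; exact: Gds.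
have [eta4 eta40 HGp] := pospart_curve G_diff Gz Gds' e0.
pose eta := Num.min (eta1 / 2) (Num.min eta2 (Num.min eta3 eta4)).
have eta0 : 0 < eta by rewrite !lt_min eta20 eta30 eta40 divr_gt0.
have gds' i : g zb 0 i = 0 -> 'd g zb (row_mx us vs) 0 i <= 0.
  by rewrite dsE => /eqP; exact: gds.
have Hcurve := feasible_curve g_qc g_diff ms gz feas gds' eta0.
have [c c0 Hc] := moreau_lower f_diff g_diff gz g_qc rho0 f_wc gam0 gamlt.
pose M := enorm ds + eta; have M0 : 0 < M by rewrite ltr_wpDl// enorm_ge0.
have cM : 0 < c * M ^+ 2 + 1 by rewrite ltr_wpDl// mulr_ge0// sqr_ge0.
have B0 : 0 < th + 2 * e + e by lra.
suff : \forall t \near (0 : R)^'+,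
    0 <= 'd F zb ds + e + al * (th + 2 * e + e) by move=> /filter_ex[].
near=> t.
have t0 : 0 < t by near: t; exact: nbhs_right_gt.
have [w' w'v gw'] : exists2 w', enorm (w' - vs) <= eta &
  nonpos (g (zb + t *: row_mx us w')) by near: t.
set k := row_mx us w' in gw'.
have kds : enorm (k - ds) <= eta.
  by rewrite -dsE opp_row_mx add_row_mx subrr enorm_row0mx.
have [kds1 kds2 kds3 kds4] : [/\ enorm (k - ds) <= eta1 / 2,
    enorm (k - ds) <= eta2, enorm (k - ds) <= eta3 & enorm (k - ds) <= eta4].
  by move: kds; rewrite !le_min => /and4P[].
have kd : enorm (k - d) <= eta1.
  have -> : k - d = (k - ds) + s *: h.
    by rewrite /ds opprD addrA subrK.
  rewrite (le_trans (enormD _ _))// enormZ gtr0_norm//.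
  have : s * enorm h <= s * (enorm h + 1) by rewrite ler_pM2l// lerDl.
  lra.
have kM : enorm k <= M.
  by rewrite -[k](subrK ds) (le_trans (enormD _ _))// addrC lerD2l.
have Ft : `|F (zb + t *: k) - F zb - t * 'd F zb ds| <= e * t.
  have : forall h', enorm (h' - ds) <= eta2 ->
    `|F (zb + t *: h') - F zb - t * 'd F zb ds| <= e * t by near: t.
  exact.
have ft : `|f (zb + t *: k) - f zb - t * 'd f zb ds| <= e * t.
  have : forall h', enorm (h' - ds) <= eta3 ->
    `|f (zb + t *: h') - f zb - t * 'd f zb ds| <= e * t by near: t.
  exact.
have Gt : enorm (pospart (G (zb + t *: k))) <= e * t.
  have : forall d', enorm (d' - ds) <= eta4 ->
    enorm (pospart (G (zb + t *: d'))) <= e * t by near: t.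
  exact.
have dirt : dir_nbhd eps del d (t *: k).
  have : forall d', enorm (d' - d) <= eta1 -> dir_nbhd eps del d (t *: d').
    by near: t.
  exact.
pose zt := zb + t *: k.
pose ell := f zb + t * lagr_slope f g xb yb lam us - c * enorm (t *: k) ^+ 2.
have ellE : (ell%:E <= moreau_pair f g gam zt)%E.
  have := Hc lam zt lm; congr (_ <= _)%E; congr (_%:E).
  have -> : zt - row_mx xb yb = t *: k by rewrite /zt addrAC subrr add0r.
  congr (_ + _ - _).
  have -> : lsubmx zt - xb = t *: us.
    by rewrite /zt linearD linearZ/= !row_mxKl addrAC subrr add0r.
  rewrite /lagr_slope.
  have -> : row_mx (t *: us) 0 = t *: row_mx us 0 :> 'rV[R]_(n + m).
    by rewrite scale_row_mx scaler0.
  by rewrite !linearZ/= dotZl mulrDr.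
(* Perturbations for which zt is feasible: ell stands in for the envelope, so
   that the size of a can be computed. *)
pose a := ell - f zt.
pose b : 'rV[R]_q := - pospart (G zt).
have at_le : `|a| <= t * (th + 2 * e).
  have tc : t * (c * M ^+ 2 + 1) <= e.
    rewrite -ler_pdivlMr//; near: t; apply: nbhs_right_le; exact: divr_gt0.
  have q0 : 0 <= c * enorm (t *: k) ^+ 2 by rewrite mulr_ge0// sqr_ge0.
  have qle : c * enorm (t *: k) ^+ 2 <= t * e.
    rewrite enormZ gtr0_norm// exprMn.
    have : t * (t * (c * M ^+ 2 + 1)) <= t * e by rewrite ler_pM2l.
    apply: le_trans; rewrite mulrCA expr2 -mulrA !ler_pM2l//.
    rewrite (@le_trans _ _ (c * M ^+ 2))//; last by rewrite lerDl.
    by rewrite ler_wpM2l// ler_pXn2r ?nnegrE ?enorm_ge0// ltW.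
  have sl : lagr_slope f g xb yb lam us = 'd f zb ds - th.
    by rewrite (lagr_slope_split f_diff g_diff us vs lm) dsE thE.
  have tth : 0 <= t * th by rewrite mulr_ge0// ltW.
  have te : 0 < t * e by rewrite mulr_gt0.
  rewrite /a /ell sl; move: ft; rewrite !ler_norml; lra.
have nab : enorm (row_mx (a%:M : 'rV[R]_1) b) <= t * (th + 2 * e) + e * t.
  have -> : row_mx (a%:M : 'rV[R]_1) b = row_mx a%:M 0 + row_mx 0 b.
    by rewrite add_row_mx addr0 add0r.
  rewrite (le_trans (enormD _ _))// enorm_row_mx0 enorm_row0mx lerD//.
    by rewrite (le_trans (enorm_le_sum _))// big_ord1 mxE eqxx.
  by rewrite enormN.
have := calm a b zt.
have E : zt - zb = t *: k by rewrite /zt addrAC subrr add0r.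
rewrite E gph_lowerE -/zt in gw' *.
move=> /(_ _ gw' dirt)/wrap[].
  rewrite (le_lt_trans nab)// (_ : _ + _ = t * (th + 2 * e + e)); last by ring.
  by rewrite -ltr_pdivlMr//; near: t; apply: nbhs_right_lt; exact: divr_gt0.
move=> /(_ _ _)/wrap[].
  move: ellE; rewrite /a; case: (moreau_pair f g gam zt) => [r| |]//=.
    by rewrite -EFinB -EFinD !lee_fin; lra.
  by move=> _; rewrite leNye.
  by move=> i; rewrite !mxE subr_le0 le_max lexx.
move=> H.
have : al * enorm (row_mx (a%:M : 'rV[R]_1) b) <= al * (t * (th + 2 * e) + e * t).
  by rewrite ler_pM2l.
rewrite -(pmulr_rge0 _ t0).
move: Ft H; rewrite -/zt ler_norml; lra.
Unshelve. all: by end_near. Qed.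

End ValueProgram.

Theorem theorem5p2 (R : realType) (n m p q : nat)
  (F f : 'rV[R]_(n + m) -> R) (g : 'rV[R]_(n + m) -> 'rV[R]_p)
  (G : 'rV[R]_(n + m) -> 'rV[R]_q) (rho_f gam : R)
  (xb : 'rV[R]_n) (yb : 'rV[R]_m) (zb := row_mx xb yb)
  (F_C1 : C1 F) (f_C1 : C1 f) (g_C1 : C1 g) (G_C1 : C1 G)
  (g_qc : quasi_convex g)
  (rho_gt0 : 0 < rho_f) (f_wc : weakly_convex rho_f (gph_lower g) f)
  (gam_gt0 : 0 < gam) (gam_lt : gam < 1 / rho_f)
  (zb_min : is_local_min (VP_feas f g G gam) F zb)
  (feas_near : \forall x \near xb, lower_feas g x !=set0)
  (mscq : MSCQ g zb) :
  critical_cone F f g G gam zb =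
    [set d | [/\ is_max [set 'd (fun x => lagr f g x yb lam) xb (lsubmx d)
                        | lam in multipliers f g xb yb] ('d f zb d),
                 'd F zb d <= 0,
                 forall i, g zb 0 i = 0 -> 'd g zb d 0 i <= 0
               & forall i, G zb 0 i = 0 -> 'd G zb d 0 i <= 0]]
  /\
  forall (u : 'rV[R]_n) (v : 'rV[R]_m),
    critical_cone F f g G gam zb (row_mx u v) ->
    partially_calm F f g G gam zb (row_mx u v) ->
    exists (alpha : R) (lam_g : 'rV[R]_p) (lam_G : 'rV[R]_q)
           (lamb : 'rV[R]_p),
      dir_multipliers f g xb yb u v lamb /\
      0 = grad F zb + jacT g zb (lam_g - alpha *: lamb) + jacT G zb lam_G /\
      0 <= alpha /\
      nonneg lam_g /\ dot lam_g (g zb) = 0 /\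
      dot lam_g ('d g zb (row_mx u v)) = 0 /\
      nonneg lam_G /\ dot lam_G (G zb) = 0 /\
      dot lam_G ('d G zb (row_mx u v)) = 0.
Proof.
have F_diff := F_C1.1 zb; have f_diff := f_C1.1 zb.
have g_diff := g_C1.1 zb; have G_diff := G_C1.1 zb.
have zb_feas := zb_min.1; split.
  exact: (critical_coneE F f_diff g_diff g_qc rho_gt0 f_wc gam_gt0 gam_lt zb_feas
    feas_near mscq).
move=> u v cd calm.
have [lam lamP] :=
  critical_dir_multiplier f_diff g_diff g_qc gam_gt0 zb_feas feas_near mscq cd.
have [al al0 pen] := partially_calm_penalty F_diff f_diff g_diff G_diff g_qc
  rho_gt0 f_wc gam_gt0 gam_lt zb_feas feas_near mscq cd lamP calm.
(* Constraints are selected when they are active at zb and stay so along d, which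
   gives both complementarity conditions at once. *)
pose d := row_mx u v.
have [||mu [nu [mu0 nu0 muP nuP E]]] := @farkas_pair R _ p q ('d g zb) ('d G zb)
  [pred i | (g zb 0 i == 0) && ('d g zb d 0 i == 0)]
  [pred i | (G zb 0 i == 0) && ('d G zb d 0 i == 0)]
  (fun h => 'd F zb h - al * dot ('d g zb h) lam).
- move=> s x y.
  have -> : 'd F zb (s *: x + y) = s * 'd F zb x + 'd F zb y by rewrite linearP.
  by rewrite linearP dotDl dotZl; ring.
- move=> h gh Gh; apply: pen => i zi di; [apply: gh | apply: Gh];
    by rewrite inE zi di !eqxx.
have mu_supp i : g zb 0 i != 0 \/ 'd g zb d 0 i != 0 -> mu 0 i = 0.
  by move=> H; apply: muP; rewrite inE negb_and; exact/orP.
have nu_supp i : G zb 0 i != 0 \/ 'd G zb d 0 i != 0 -> nu 0 i = 0.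
  by move=> H; apply: nuP; rewrite inE negb_and; exact/orP.
exists al, mu, nu, lam; split=> //; split.
  apply/rowP => i; rewrite [LHS]mxE [RHS]mxE [X in _ = X + _]mxE !jacTE.
  rewrite [grad _ _ _ _]mxE [LHS](E (delta_mx 0 i)).
  by rewrite dotBl dotZl (dotC lam); ring.
split=> //; split=> //.
split; first by apply: dot_supp_eq0 => i ?; apply: mu_supp; left.
split; first by apply: dot_supp_eq0 => i ?; apply: mu_supp; right.
split=> //.
split; first by apply: dot_supp_eq0 => i ?; apply: nu_supp; left.
by apply: dot_supp_eq0 => i ?; apply: nu_supp; right.
Qed.
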